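(* Let $n\in \mathbb{Z}_{\ge 1}$. Let $H$ be a compact metrizable space and let $v_1,\dots,v_{n+1}$ be pairwise distinct points of $H$. Let $(X_1,d_1,a_1),\dots,(X_{n+1},d_{n+1},a_{n+1})$ be elements of $\mathscr{PZ}$ such that $\mathcal{GH}_*((X_i,d_i,a_i),(X_j,d_j,a_j))>0$ for all distinct $i,j$. Then there exists a topological embedding $\Phi:H\to\mathscr{PZ}$ (with respect to the metric $\mathcal{GH}_*$) such that $\Phi(v_i)=(X_i,d_i,a_i)$ for all $i$.
   Context: A metric space is proper if all its bounded closed subsets are compact. A pointed metric space is a triple $(X,d,a)$ with $a\in X$. $\mathscr{PM}$ is the set of pointed isometry classes of pointed proper metric spaces. For a metric space $(X,d)$, $B_d(x,r)$ is the closed ball and $N_d(A,r)=\{x: \exists a\in A,\ d(x,a)<r\}$. For $t\in(0,\infty)$ and pointed metric spaces $(X,d,a),(Y,e,b)$, a metric $h$ on the disjoint union $X\sqcup Y$ is $(t;a,b)$-admissible if $h|_{X^2}=d$, $h|_{Y^2}=e$, $h(a,b)<t$, $B_h(a,t^{-1})\subset N_h(Y,t)$ and $B_h(b,t^{-1})\subset N_h(X,t)$. Let $\mathcal{GH}'_*$ be the infimum of all $t$ for which a $(t;a,b)$-admissible metric exists, and $\mathcal{GH}_*=\min\{\mathcal{GH}'_*,1/2\}$; this is a metric on $\mathscr{PM}$ (the pointed Gromov--Hausdorff distance). A CAT(0) space is a geodesic space (any two points $x,y$ joined by a map $\gamma:[0,1]\to X$ with $d(\gamma(s),\gamma(t))=|s-t|d(x,y)$)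 satisfying the CAT(0) comparison inequality for all geodesic triangles with respect to Euclidean comparison triangles. $\mathscr{PZ}$ is the set of all elements of $\mathscr{PM}$ that are CAT(0) spaces. *)

(* Defs.v *)
From Stdlib Require Import Reals List.
From Coquelicot Require Import Rbar Lub.
Open Scope R_scope.

Definition is_metric {T : Type} (d : T -> T -> R) : Prop :=
  (forall x, d x x = 0) /\
  (forall x y, d x y = 0 -> x = y) /\
  (forall x y, d x y = d y x) /\
  (forall x y z, d x z <= d x y + d y z).

Definition mopen {T : Type} (d : T -> T -> R) (U : T -> Prop) : Prop :=
  forall x, U x -> exists r, 0 < r /\ forall y, d x y < r -> U y.

Definition mclosed {T : Type} (d : T -> T -> R) (A : T -> Prop) : Prop :=
  mopen d (fun x => ~ A x).

Definition mbounded {T : Type} (d : T -> T -> R) (A : T -> Prop) : Prop :=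
  exists x r, forall y, A y -> d x y <= r.

Definition mcompact {T : Type} (d : T -> T -> R) (A : T -> Prop) : Prop :=
  forall (I : Type) (U : I -> T -> Prop),
    (forall i, mopen d (U i)) ->
    (forall x, A x -> exists i, U i x) ->
    exists l : list I, forall x, A x -> exists i, In i l /\ U i x.

Definition mproper {T : Type} (d : T -> T -> R) : Prop :=
  forall A, mclosed d A -> mbounded d A -> mcompact d A.

Record PMS : Type := {
  car : Type;
  dist : car -> car -> R;
  pt : car;
  dist_metric : is_metric dist;
  dist_proper : mproper dist }.

(** pointed isometry (equality in the set of pointed isometry classes) *)
Definition pointed_isometric (X Y : PMS) : Prop :=
  exists f : car X -> car Y,
    (forall x x', dist Y (f x) (f x') = dist X x x') /\
    (forall y, exists x, f x = y) /\
    f (pt X) = pt Y.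

Definition admissible (X Y : PMS) (t : R)
    (h : (car X + car Y)%type -> (car X + car Y)%type -> R) : Prop :=
  is_metric h /\
  (forall x x', h (inl x) (inl x') = dist X x x') /\
  (forall y y', h (inr y) (inr y') = dist Y y y') /\
  h (inl (pt X)) (inr (pt Y)) < t /\
  (forall z, h (inl (pt X)) z <= / t -> exists y, h z (inr y) < t) /\
  (forall z, h (inr (pt Y)) z <= / t -> exists x, h z (inl x) < t).

Definition GHprime (X Y : PMS) : Rbar :=
  Glb_Rbar (fun t => 0 < t /\ exists h, admissible X Y t h).

Definition GHstar (X Y : PMS) : R :=
  real (Rbar_min (GHprime X Y) (Finite (/ 2))).

Definition geodesic_between (X : PMS) (x y : car X) (g : R -> car X) : Prop :=
  g 0 = x /\ g 1 = y /\
  forall s t, 0 <= s <= 1 -> 0 <= t <= 1 ->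
    dist X (g s) (g t) = Rabs (s - t) * dist X x y.

Definition geodesic_space (X : PMS) : Prop :=
  forall x y : car X, exists g, geodesic_between X x y g.

Definition eucl (p q : R * R) : R :=
  sqrt ((fst p - fst q) ^ 2 + (snd p - snd q) ^ 2).

Definition lerp (p q : R * R) (s : R) : R * R :=
  ((1 - s) * fst p + s * fst q, (1 - s) * snd p + s * snd q).

Definition CAT0_ineq (X : PMS) : Prop :=
  forall (p q r : car X) (g1 g2 g3 : R -> car X) (P Q Rr : R * R),
    geodesic_between X p q g1 -> geodesic_between X q r g2 ->
    geodesic_between X r p g3 ->
    eucl P Q = dist X p q -> eucl Q Rr = dist X q r -> eucl Rr P = dist X r p ->
    forall (i j : nat) (s t : R), 0 <= s <= 1 -> 0 <= t <= 1 ->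
      let side k := match k with 0%nat => g1 | 1%nat => g2 | _ => g3 end in
      let cside k := match k with 0%nat => lerp P Q | 1%nat => lerp Q Rr
                                  | _ => lerp Rr P end in
      dist X (side i s) (side j t) <= eucl (cside i s) (cside j t).

Definition CAT0 (X : PMS) : Prop := geodesic_space X /\ CAT0_ineq X.

Definition GH_embedding {H : Type} (dH : H -> H -> R) (Phi : H -> PMS) : Prop :=
  (forall x, CAT0 (Phi x)) /\
  (forall x y, pointed_isometric (Phi x) (Phi y) -> x = y) /\
  (forall x eps, 0 < eps -> exists delta, 0 < delta /\
     forall y, dH x y < delta -> GHstar (Phi y) (Phi x) < eps) /\
  (forall x delta, 0 < delta -> exists eps, 0 < eps /\
     forall y, GHstar (Phi y) (Phi x) < eps -> dH x y < delta).

(* Main.v *)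
(* Represent [x : H] by a wedge, at the base point, of the given spaces X_i and
   of real lines ("legs"), each branch being cut at a radius depending
   continuously on [x].  At [v i] the branch X_i is whole and the others shrink
   to the base point.  Legs come in levels k = 0, 1, ..., of rapidly decreasing
   lengths governed by bump functions that vanish at every [v i] and separate
   the other points of H; level k has more legs than the covering number, at
   the scale of its length, of the unit ball formed by the X_i and the lower
   levels.  A packing argument near the base point thus tells from the pointed
   isometry class whether the k-th bump is 1 or 0 at [x], which gives
   injectivity; compactness of H does the rest.
   CAT(0) is handled through Stewart's inequality, which passes to wedges by
   elementary algebra, and radial truncations are convex. *)
From Stdlib Require Import Reals Lra Lia List Arith Cantor.
From Stdlib Require Import ClassicalEpsilon.
From Coquelicot Require Import Rcomplements Rbar Lub.
Require Import Defs.
Import ListNotations.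
Open Scope R_scope.
Set Bullet Behavior "Strict Subproofs".

(** The X_i are arbitrary, so nothing in the shape of a leg can mark it off from them; only a count
    can. Balls of radius half a leg length cover the lower levels in finitely many pieces, the tips
    of the current level need a piece each, and the ratio [/ 8] between consecutive lengths puts all
    higher levels into the single ball around the base point. The count tolerates errors up to half
    a leg length, so it refutes closeness and not merely isometry. H may be infinite-dimensional,
    hence infinitely many bumps, whose Lipschitz constants grow with the index; the factor
    [leg_scale k] absorbs this growth, and all radii share one Lipschitz constant. The cutting
    parameter rho lives in [0,1] and the radius is rho/(1-rho), so an unbounded X_i is reached
    continuously at rho = 1. The wedge stays a pseudometric on the disjoint union of the branches,
    with one base point per branch; representatives are chosen only after truncation. Stewart's
    inequality speaks of distances alone and survives this by restriction. *)

Definition is_pseudo {T : Type} (d : T -> T -> R) : Prop :=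
  (forall x, d x x = 0) /\
  (forall x y, d x y = d y x) /\
  (forall x y z, d x z <= d x y + d y z).

Lemma pseudo_nonneg {T : Type} (d : T -> T -> R) (Hd : is_pseudo d) x y :
  0 <= d x y.
Proof.
destruct Hd as (d0 & ds & dt).
pose proof (dt x y x). rewrite d0, (ds y x) in H. lra.
Qed.

Lemma metric_pseudo {T : Type} (d : T -> T -> R) : is_metric d -> is_pseudo d.
Proof. intros (H1 & _ & H2 & H3). repeat split; assumption. Qed.

(** * The CAT(0) condition as Stewart's inequality *)

(** The Bruhat-Tits form of CAT(0): [m] is given by its distances to [q] and [r], with no geodesic
    in sight, so the condition makes sense for pseudometrics and is inherited by subsets. *)
Definition stewart {T : Type} (d : T -> T -> R) : Prop :=
  forall p q r m t, 0 <= t <= 1 ->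
    d q m = t * d q r -> d m r = (1 - t) * d q r ->
    d p m ^ 2 <= (1 - t) * d p q ^ 2 + t * d p r ^ 2 - t * (1 - t) * d q r ^ 2.

Lemma geodesic_rev (X : PMS) x y g :
  geodesic_between X x y g -> geodesic_between X y x (fun s => g (1 - s)).
Proof.
intros (g0 & g1 & H). split; [|split].
- now replace (1 - 0) with 1 by ring.
- now replace (1 - 1) with 0 by ring.
- intros s t Hs Ht. rewrite H by lra.
  rewrite (proj1 (proj2 (metric_pseudo _ (dist_metric X))) y x).
  f_equal. replace (1 - s - (1 - t)) with (- (s - t)) by ring. apply Rabs_Ropp.
Qed.

Lemma geodesic_dist0 (X : PMS) x y g s :
  geodesic_between X x y g -> 0 <= s <= 1 -> dist X x (g s) = s * dist X x y.
Proof.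
intros (g0 & g1 & H) Hs. rewrite <- g0 at 1. rewrite H by lra.
rewrite Rabs_left1; lra.
Qed.

Lemma geodesic_dist1 (X : PMS) x y g s :
  geodesic_between X x y g -> 0 <= s <= 1 ->
  dist X (g s) y = (1 - s) * dist X x y.
Proof.
intros (g0 & g1 & H) Hs. rewrite <- g1 at 1. rewrite H by lra.
rewrite Rabs_left1; lra.
Qed.

Lemma eucl_sq p q : eucl p q ^ 2 = (fst p - fst q) ^ 2 + (snd p - snd q) ^ 2.
Proof.
unfold eucl. rewrite pow2_sqrt; [reflexivity|].
pose proof (pow2_ge_0 (fst p - fst q)); pose proof (pow2_ge_0 (snd p - snd q)).
lra.
Qed.

Lemma eucl_nonneg p q : 0 <= eucl p q.
Proof. apply sqrt_pos. Qed.

Lemma sq_eq_nonneg a b : 0 <= a -> 0 <= b -> a ^ 2 = b ^ 2 -> a = b.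
Proof. intros; nra. Qed.

Lemma sq_le_nonneg a b : 0 <= b -> a ^ 2 <= b ^ 2 -> a <= b.
Proof. intros; nra. Qed.

(** The law of cosines gives the foot [u] of the altitude; Heron's factorisation, whose factors are
    the perimeter and the three triangle defects, shows that the squared altitude is nonnegative. *)
Lemma comparison_triangle a b c :
  0 <= a -> 0 < b -> 0 <= c -> c <= a + b -> a <= b + c -> b <= a + c ->
  exists u w, u ^ 2 + w ^ 2 = a ^ 2 /\ (u - b) ^ 2 + w ^ 2 = c ^ 2.
Proof.
intros Ha Hb Hc H1 H2 H3.
set (u := (a ^ 2 + b ^ 2 - c ^ 2) / (2 * b)).
assert (Hu : 2 * b * u = a ^ 2 + b ^ 2 - c ^ 2) by (unfold u; field; lra).
assert (Hau : 0 <= a ^ 2 - u ^ 2).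
{ assert (0 <= (2 * b) ^ 2 * (a ^ 2 - u ^ 2)).
  { replace ((2 * b) ^ 2 * (a ^ 2 - u ^ 2))
      with ((2 * a * b - 2 * b * u) * (2 * a * b + 2 * b * u)) by ring.
    rewrite Hu.
    replace (2 * a * b - (a ^ 2 + b ^ 2 - c ^ 2))
      with ((c - (a - b)) * (c + (a - b))) by ring.
    replace (2 * a * b + (a ^ 2 + b ^ 2 - c ^ 2))
      with (((a + b) - c) * ((a + b) + c)) by ring.
    repeat apply Rmult_le_pos; lra. }
  apply Rmult_le_reg_l with ((2 * b) ^ 2); [nra | lra]. }
exists u, (sqrt (a ^ 2 - u ^ 2)). rewrite pow2_sqrt by assumption.
split; [ring | nra].
Qed.

(* The vertex-to-side case of the comparison inequality.  Stewart's theorem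
   computes the Euclidean side; the geodesic through [m] is replaced by an
   arbitrary one because [m] lies at zero distance from it. *)
Lemma CAT0_stewart (X : PMS) : CAT0 X -> stewart (dist X).
Proof.
intros [HG HC].
pose proof (metric_pseudo _ (dist_metric X)) as HX.
pose proof (pseudo_nonneg _ HX) as Hp.
destruct (dist_metric X) as (d0 & dsep & dsym & dtri).
assert (key : forall p q r g t, geodesic_between X q r g -> 0 <= t <= 1 ->
  dist X p (g t) ^ 2 <= (1 - t) * dist X p q ^ 2 + t * dist X p r ^ 2
     - t * (1 - t) * dist X q r ^ 2).
{ intros p q r g t Hg Ht.
  destruct (Rle_lt_dec (dist X q r) 0) as [Hz | Hz].
  - assert (Hqr : dist X q r = 0) by (pose proof (Hp q r); lra).
    pose proof (geodesic_dist0 X q r g t Hg Ht) as Hm. rewrite Hqr in Hm.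
    rewrite Rmult_0_r in Hm.
    apply dsep in Hm. apply dsep in Hqr. rewrite <- Hm, <- Hqr, d0. lra.
  - destruct (HG p q) as [g1 Hg1]. destruct (HG r p) as [g3 Hg3].
    destruct (comparison_triangle (dist X p q) (dist X q r) (dist X r p))
      as (u & w & E1 & E2); auto.
    { rewrite (dsym r p). apply dtri. }
    { pose proof (dtri p r q). rewrite (dsym p r), (dsym r q) in *. lra. }
    { rewrite (dsym p q), (dsym r p). apply dtri. }
    assert (K := HC p q r g1 g g3 (u, w) (0, 0) (dist X q r, 0) Hg1 Hg Hg3).
    assert (A1 : eucl (u, w) (0, 0) = dist X p q).
    { apply sq_eq_nonneg; auto using eucl_nonneg. rewrite eucl_sq; simpl fst; simpl snd.
      rewrite <- E1; ring. }
    assert (A2 : eucl (0, 0) (dist X q r, 0) = dist X q r).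
    { apply sq_eq_nonneg; auto using eucl_nonneg. rewrite eucl_sq; simpl fst; simpl snd. ring. }
    assert (A3 : eucl (dist X q r, 0) (u, w) = dist X r p).
    { apply sq_eq_nonneg; auto using eucl_nonneg. rewrite eucl_sq; simpl fst; simpl snd.
      rewrite <- E2; ring. }
    specialize (K A1 A2 A3 0%nat 1%nat 0 t ltac:(lra) Ht). cbv beta iota zeta in K.
    destruct Hg1 as (g10 & _). rewrite g10 in K.
    apply (fun H => pow_incr _ _ 2 (conj (Hp _ _) H)) in K.
    eapply Rle_trans; [exact K|]. rewrite eucl_sq. unfold lerp; simpl fst; simpl snd.
    rewrite (dsym p r), <- E2, <- E1. apply Req_le. ring. }
intros p q r m t Ht H1 H2.
destruct (HG q r) as [g Hg].
assert (Hm : m = g t).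
{ pose proof (key m q r g t Hg Ht) as K.
  rewrite (dsym m q), H1, H2 in K.
  apply dsep. pose proof (Hp m (g t)). nra. }
rewrite Hm. apply key; assumption.
Qed.

(** With a, b the distances from [o] to [q], [r] and L that from [q] to [r], Stewart's bound equals
    ((1-t)a + tb)^2 + t(1-t)((a-b)^2 - L^2), and |a-b| <= L. *)
Lemma stewart_convex {T : Type} (d : T -> T -> R) (Hd : is_pseudo d) :
  stewart d -> forall o q r m t, 0 <= t <= 1 ->
  d q m = t * d q r -> d m r = (1 - t) * d q r ->
  d o m <= (1 - t) * d o q + t * d o r.
Proof.
intros HS o q r m t Ht H1 H2. pose proof (HS o q r m t Ht H1 H2) as K.
pose proof (pseudo_nonneg d Hd) as Hp. destruct Hd as (d0 & dsym & dtri).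
pose proof (Hp o q); pose proof (Hp o r).
apply sq_le_nonneg; [nra|].
assert ((d o q - d o r) ^ 2 <= d q r ^ 2).
{ apply pow_maj_Rabs. apply Rabs_le.
  pose proof (dtri o q r); pose proof (dtri o r q). rewrite (dsym r q) in *. lra. }
assert (0 <= t * (1 - t)) by nra. nra.
Qed.

(** Two applications of Stewart bound first the distance from [r] to [x], then that from [x] to [y].
    In the plane both are equalities, so the resulting bound is the comparison distance itself. *)
Lemma stewart_two_sides {T : Type} (d : T -> T -> R) (Hd : is_pseudo d) :
  stewart d -> forall p q r x y s t P Q S, 0 <= s <= 1 -> 0 <= t <= 1 ->
  d p x = s * d p q -> d x q = (1 - s) * d p q ->
  d p y = t * d p r -> d y r = (1 - t) * d p r ->
  eucl P Q = d p q -> eucl P S = d p r -> eucl Q S = d q r ->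
  d x y <= eucl (lerp P Q s) (lerp P S t).
Proof.
intros HS p q r x y s t P Q S Hs Ht Hx1 Hx2 Hy1 Hy2 E1 E2 E3.
pose proof (HS x p r y t Ht Hy1 Hy2) as K1.
pose proof (HS r p q x s Hs Hx1 Hx2) as K2.
destruct Hd as (d0 & dsym & dtri).
apply sq_le_nonneg; [apply eucl_nonneg|].
rewrite (dsym x p), Hx1, (dsym x r) in K1.
rewrite (dsym r p), (dsym r q) in K2.
apply Rle_trans with ((1 - t) * (s * d p q) ^ 2 +
  t * ((1 - s) * d p r ^ 2 + s * d q r ^ 2 - s * (1 - s) * d p q ^ 2)
  - t * (1 - t) * d p r ^ 2); [nra|].
rewrite <- E1, <- E2, <- E3.
replace ((s * eucl P Q) ^ 2) with (s ^ 2 * eucl P Q ^ 2) by ring.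
rewrite !eucl_sq. unfold lerp; simpl fst; simpl snd. apply Req_le. ring.
Qed.

Lemma lerp_rev P Q s : lerp P Q s = lerp Q P (1 - s).
Proof. unfold lerp. f_equal; ring. Qed.

Lemma eucl_sym P Q : eucl P Q = eucl Q P.
Proof. unfold eucl. f_equal. ring. Qed.

Lemma eucl_lerp P Q s t : eucl (lerp P Q s) (lerp P Q t) = Rabs (s - t) * eucl P Q.
Proof.
apply sq_eq_nonneg; auto using eucl_nonneg.
{ apply Rmult_le_pos; auto using eucl_nonneg, Rabs_pos. }
rewrite Rpow_mult_distr, pow2_abs.
rewrite !eucl_sq. unfold lerp; simpl fst; simpl snd. ring.
Qed.

Lemma stewart_CAT0 (X : PMS) : geodesic_space X -> stewart (dist X) -> CAT0 X.
Proof.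
intros HG HS. split; [assumption|].
pose proof (metric_pseudo _ (dist_metric X)) as HX.
pose proof HX as (d0 & dsym & dtri).
assert (two : forall p q r g g' P Q S s t,
  geodesic_between X p q g -> geodesic_between X p r g' ->
  eucl P Q = dist X p q -> eucl P S = dist X p r -> eucl Q S = dist X q r ->
  0 <= s <= 1 -> 0 <= t <= 1 ->
  dist X (g s) (g' t) <= eucl (lerp P Q s) (lerp P S t)).
{ intros. apply (stewart_two_sides _ HX HS p q r); auto;
    auto using geodesic_dist0, geodesic_dist1. }
intros p q r g1 g2 g3 P Q S H1 H2 H3 E1 E2 E3 i j s t Hs Ht side cside.
assert (same : forall x y g A B u v, geodesic_between X x y g -> eucl A B = dist X x y ->
  0 <= u <= 1 -> 0 <= v <= 1 -> dist X (g u) (g v) <= eucl (lerp A B u) (lerp A B v)).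
{ intros x y g A B u v (_ & _ & Hg) E Hu Hv. rewrite Hg, eucl_lerp, E by assumption. lra. }
pose proof (geodesic_rev _ _ _ _ H1) as H1'.
pose proof (geodesic_rev _ _ _ _ H2) as H2'.
pose proof (geodesic_rev _ _ _ _ H3) as H3'.
(* Two sides meeting at a vertex both start there once one of them is reversed. *)
assert (C01 : forall s t, 0 <= s <= 1 -> 0 <= t <= 1 ->
   dist X (g1 s) (g2 t) <= eucl (lerp P Q s) (lerp Q S t)).
{ intros a b Ha Hb. rewrite (lerp_rev P Q).
  replace (g1 a) with (g1 (1 - (1 - a))) by (f_equal; ring).
  apply (two q p r (fun a => g1 (1 - a)) g2); auto; try lra;
    rewrite ?(eucl_sym Q P), ?(eucl_sym P S), ?(dsym q p), ?(dsym p r); auto. }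
assert (C02 : forall s t, 0 <= s <= 1 -> 0 <= t <= 1 ->
   dist X (g1 s) (g3 t) <= eucl (lerp P Q s) (lerp S P t)).
{ intros a b Ha Hb. rewrite (lerp_rev S P).
  replace (g3 b) with (g3 (1 - (1 - b))) by (f_equal; ring).
  apply (two p q r g1 (fun a => g3 (1 - a))); auto; try lra;
    rewrite ?(eucl_sym P S), ?(dsym p r); auto. }
assert (C12 : forall s t, 0 <= s <= 1 -> 0 <= t <= 1 ->
   dist X (g2 s) (g3 t) <= eucl (lerp Q S s) (lerp S P t)).
{ intros a b Ha Hb. rewrite (lerp_rev Q S).
  replace (g2 a) with (g2 (1 - (1 - a))) by (f_equal; ring).
  apply (two r q p (fun a => g2 (1 - a)) g3); auto; try lra;
    rewrite ?(eucl_sym S Q), ?(eucl_sym Q P), ?(dsym r q), ?(dsym q p); auto. }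
destruct i as [|[|i]], j as [|[|j]]; unfold side, cside; eauto;
  rewrite dsym, eucl_sym; auto.
Qed.

(** * The wedge of pointed spaces as a pseudometric space *)

Section Wedge.

Context {I : Type} (Y : I -> PMS).

Definition branch_pt : Type := {i : I & car (Y i)}.

Definition bpt (i : I) (z : car (Y i)) : branch_pt := existT _ i z.

Definition height (p : branch_pt) : R :=
  dist (Y (projT1 p)) (pt (Y (projT1 p))) (projT2 p).

(* The base points of all branches lie at distance 0 from each other. *)
Definition wdist (p q : branch_pt) : R :=
  match excluded_middle_informative (projT1 p = projT1 q) with
  | left e =>
      dist (Y (projT1 q)) (eq_rect _ (fun i => car (Y i)) (projT2 p) _ e) (projT2 q)
  | right _ => height p + height q
  end.

Lemma wdist_same i z w : wdist (bpt i z) (bpt i w) = dist (Y i) z w.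
Proof.
unfold wdist, bpt; simpl.
destruct (excluded_middle_informative (i = i)) as [e | n]; [|now destruct n].
now rewrite (proof_irrelevance _ e eq_refl).
Qed.

Lemma wdist_diff i j z w :
  i <> j -> wdist (bpt i z) (bpt j w) = height (bpt i z) + height (bpt j w).
Proof.
intros n. unfold wdist. simpl.
destruct (excluded_middle_informative (i = j)) as [e | _]; [now destruct n | easy].
Qed.

Lemma height_pt i : height (bpt i (pt (Y i))) = 0.
Proof. apply (dist_metric (Y i)). Qed.

Lemma height_nonneg p : 0 <= height p.
Proof. apply pseudo_nonneg, metric_pseudo, dist_metric. Qed.

Lemma wdist_pt i p : wdist (bpt i (pt (Y i))) p = height p.
Proof.
destruct p as [j w]. change (existT _ j w) with (bpt j w).
destruct (excluded_middle_informative (i = j)) as [e | n].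
- subst j. now rewrite wdist_same.
- rewrite wdist_diff, height_pt by assumption. ring.
Qed.

Lemma wdist_sym p q : wdist p q = wdist q p.
Proof.
destruct p as [i z], q as [j w]. fold (bpt i z) (bpt j w).
destruct (excluded_middle_informative (i = j)) as [e | n].
- subst j. rewrite !wdist_same. apply (dist_metric (Y i)).
- rewrite !wdist_diff by auto. ring.
Qed.

Lemma wdist_le_height p q : wdist p q <= height p + height q.
Proof.
destruct p as [i z], q as [j w]. fold (bpt i z) (bpt j w).
destruct (excluded_middle_informative (i = j)) as [e | n].
- subst j. rewrite wdist_same. unfold height; simpl.
  destruct (dist_metric (Y i)) as (_ & _ & ds & dt).
  rewrite (ds (pt _) z). apply dt.
- rewrite wdist_diff by auto. lra.
Qed.

Lemma height_lip p q : height q <= height p + wdist p q.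
Proof.
destruct p as [i z], q as [j w]. fold (bpt i z) (bpt j w).
destruct (excluded_middle_informative (i = j)) as [e | n].
- subst j. rewrite wdist_same. apply (dist_metric (Y i)).
- rewrite wdist_diff by auto. pose proof (height_nonneg (bpt i z)). lra.
Qed.

Lemma wdist_pseudo : is_pseudo wdist.
Proof.
split; [|split].
- intros [i z]. fold (bpt i z). rewrite wdist_same. apply (dist_metric (Y i)).
- apply wdist_sym.
- intros p q r. pose proof (height_lip q p) as H1. pose proof (height_lip q r) as H2.
  pose proof (height_lip p q) as H3. pose proof (height_lip r q) as H4.
  rewrite (wdist_sym q p) in *. rewrite (wdist_sym r q) in *.
  pose proof (wdist_le_height p r) as H5.
  destruct p as [i z], q as [j w], r as [k u].
  fold (bpt i z) (bpt j w) (bpt k u) in *.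
  destruct (excluded_middle_informative (i = j)) as [e | n].
  + subst j. destruct (excluded_middle_informative (i = k)) as [e | n].
    * subst k. rewrite !wdist_same. apply (dist_metric (Y i)).
    * rewrite !(wdist_diff i k) in * by auto. lra.
  + rewrite (wdist_diff i j) in * by auto.
    destruct (excluded_middle_informative (j = k)) as [e | n'].
    * subst k. lra.
    * rewrite (wdist_diff j k) in * by auto. pose proof (height_nonneg (bpt j w)). lra.
Qed.

Lemma wdist_height0 p q : height p = 0 -> wdist p q = height q.
Proof.
intros H. pose proof (height_lip p q). pose proof (wdist_le_height p q). lra.
Qed.

(** Case of [p] off the branch containing [q], [r], [m]: [u] is the height of [p], and [a], [b], [x]
    are the heights of [q], [r], [m]. After expanding the squares, the cross term needs convexity of
    the height and the square term needs Stewart seen from the base point. *)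
Lemma gate_same_branch u a b x L t : 0 <= u -> 0 <= t <= 1 ->
  x <= (1 - t) * a + t * b ->
  x ^ 2 <= (1 - t) * a ^ 2 + t * b ^ 2 - t * (1 - t) * L ^ 2 ->
  (u + x) ^ 2 <= (1 - t) * (u + a) ^ 2 + t * (u + b) ^ 2 - t * (1 - t) * L ^ 2.
Proof.
intros Hu Ht H1 H2.
assert (u * x <= u * ((1 - t) * a + t * b)) by (apply Rmult_le_compat_l; assumption).
nra.
Qed.

(** Case of [p], [q], [m] in one branch and [r] in another: [L] is the height of [q], [c] that of
    [p], [e] that of [r]. Stewart is known on the part of the geodesic from [q] to the base point,
    where [m] has parameter [t']; the excess of the new bound over the old one is a nonnegative
    multiple of a^2 - (c-L)^2. *)
Lemma gate_two_branches a c L e y t t' : 0 < L -> 0 <= e -> 0 <= t' ->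
  L <= a + c -> c <= a + L -> 0 <= a -> 0 <= c ->
  t * (L + e) = t' * L ->
  y ^ 2 <= (1 - t') * a ^ 2 + t' * c ^ 2 - t' * (1 - t') * L ^ 2 ->
  y ^ 2 <= (1 - t) * a ^ 2 + t * (c + e) ^ 2 - t * (1 - t) * (L + e) ^ 2.
Proof.
intros HL He Ht' H1 H2 Ha Hc E Hy.
eapply Rle_trans; [exact Hy|].
match goal with |- ?l <= ?r => cut (0 <= r - l); [lra|] end.
assert (Et : t = t' * L / (L + e)) by (rewrite <- E; field; lra).
replace ((1 - t) * a ^ 2 + t * (c + e) ^ 2 - t * (1 - t) * (L + e) ^ 2 -
  ((1 - t') * a ^ 2 + t' * c ^ 2 - t' * (1 - t') * L ^ 2))
  with (t' * (e / (L + e)) * ((a + (c - L)) * (a - (c - L)))).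
2:{ rewrite Et. field. lra. }
apply Rmult_le_pos; [|apply Rmult_le_pos; lra].
apply Rmult_le_pos; [assumption|]. apply Rdiv_le_0_compat; lra.
Qed.

(** Case of [p] outside the branch of [q] and [m]. Put [p], [q], [r] on a line at 0, u+L, u-e: there
    Stewart is an equality, and the true distance [w] from [p] to [r] is at least |u-e|. *)
Lemma gate_far_branch u L e w x t : 0 <= t <= 1 ->
  u <= w + e -> e <= w + u ->
  x = L - t * (L + e) ->
  (u + x) ^ 2 <= (1 - t) * (u + L) ^ 2 + t * w ^ 2 - t * (1 - t) * (L + e) ^ 2.
Proof.
intros Ht H1 H2 ->.
assert ((u - e) ^ 2 <= w ^ 2) by (apply pow_maj_Rabs, Rabs_le; lra).
nra.
Qed.

Context (HY : forall i, stewart (dist (Y i))).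

Lemma stewart_gate_near i (q m : car (Y i)) r p t :
  projT1 r <> i -> 0 <= t <= 1 ->
  dist (Y i) q m = t * (height (bpt i q) + height r) ->
  height (bpt i m) + height r = (1 - t) * (height (bpt i q) + height r) ->
  wdist p (bpt i m) ^ 2 <= (1 - t) * wdist p (bpt i q) ^ 2 + t * wdist p r ^ 2
    - t * (1 - t) * wdist (bpt i q) r ^ 2.
Proof.
intros Hr Ht H1 H2. destruct r as [j r]. simpl in Hr. fold (bpt j r) in *.
rewrite (wdist_diff i j) by auto.
pose proof (height_nonneg (bpt i q)) as Nq. pose proof (height_nonneg (bpt i m)) as Nm.
pose proof (height_nonneg (bpt j r)) as Nr. pose proof (height_nonneg p) as Np.
destruct p as [k p]. fold (bpt k p) in *.
destruct (excluded_middle_informative (k = i)) as [e | n].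
- subst k. rewrite !wdist_same, (wdist_diff i j) by auto.
  pose proof (metric_pseudo _ (dist_metric (Y i))) as HP.
  pose proof (pseudo_nonneg _ HP p q) as Npq.
  pose proof (pseudo_nonneg _ HP p m) as Npm.
  pose proof HP as (d0 & ds & dt).
  assert (T1 : height (bpt i q) <= dist (Y i) p q + height (bpt i p)).
  { unfold height; simpl. rewrite Rplus_comm. apply dt. }
  assert (T2 : height (bpt i p) <= dist (Y i) p q + height (bpt i q)).
  { unfold height; simpl. rewrite Rplus_comm, (ds p q). apply dt. }
  destruct (Rle_lt_dec (height (bpt i q)) 0) as [Hz | Hz].
  + assert (E : height (bpt i q) = 0) by lra. rewrite E, ?Rplus_0_l in H1, H2, T1, T2 |- *.
    assert (E2 : t * height (bpt j r) = 0).
    { assert (0 <= t * height (bpt j r)) by (apply Rmult_le_pos; lra). lra. }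
    assert (E3 : dist (Y i) p m <= dist (Y i) p q).
    { pose proof (dt p q m). lra. }
    assert (E4 : dist (Y i) p q = height (bpt i p)).
    { pose proof (wdist_le_height (bpt i p) (bpt i q)). rewrite wdist_same in H. lra. }
    rewrite E4 in E3 |- *.
    apply Rle_trans with (height (bpt i p) ^ 2); [nra|].
    rewrite ?Rplus_0_l.
    assert (E5 : (1 - t) * height (bpt i p) ^ 2 + t * (height (bpt i p) + height (bpt j r)) ^ 2 -
      t * (1 - t) * height (bpt j r) ^ 2 = height (bpt i p) ^ 2 +
       (t * height (bpt j r)) * (2 * height (bpt i p) + t * height (bpt j r))) by ring.
    rewrite E5, E2. lra.
  (* Parameter of [m] on the geodesic from [q] to the base point of its branch. *)
  + set (t' := t * (height (bpt i q) + height (bpt j r)) / height (bpt i q)).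
    assert (Et : t * (height (bpt i q) + height (bpt j r)) = t' * height (bpt i q))
      by (unfold t'; field; lra).
    assert (Ht' : 0 <= t' <= 1).
    { split; [apply Rdiv_le_0_compat; [nra|assumption]|].
      apply Rmult_le_reg_r with (height (bpt i q)); [assumption|]. rewrite <- Et. lra. }
    apply (gate_two_branches _ _ _ _ _ _ t'); try lra.
    assert (Eq : dist (Y i) q (pt (Y i)) = height (bpt i q)) by apply ds.
    assert (Em : dist (Y i) m (pt (Y i)) = height (bpt i m)) by apply ds.
    assert (Ep : dist (Y i) p (pt (Y i)) = height (bpt i p)) by apply ds.
    rewrite <- Ep, <- Eq at 1.
    replace (height (bpt i q)) with (dist (Y i) q (pt (Y i))).
    apply HY; [assumption | rewrite Eq; lra | rewrite Eq, Em; lra].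
- rewrite !(wdist_diff k i) by auto.
  pose proof (height_lip (bpt j r) (bpt k p)). pose proof (height_lip (bpt k p) (bpt j r)).
  rewrite (wdist_sym (bpt j r)) in *.
  apply gate_far_branch; lra.
Qed.

Lemma wdist_stewart : stewart wdist.
Proof.
intros p q r m t Ht H1 H2.
pose proof (height_nonneg m) as Nm.
(* Nothing but a base point can be between [q] and [r] in a branch containing neither; [m] is then
   exchanged for the base point of the branch of [q], at distance 0. *)
assert (Hmove : forall m', height m = 0 -> height m' = 0 ->
  (wdist q m' = t * wdist q r -> wdist m' r = (1 - t) * wdist q r ->
   wdist p m' ^ 2 <= (1 - t) * wdist p q ^ 2 + t * wdist p r ^ 2
     - t * (1 - t) * wdist q r ^ 2) ->
   wdist p m ^ 2 <= (1 - t) * wdist p q ^ 2 + t * wdist p r ^ 2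
     - t * (1 - t) * wdist q r ^ 2).
{ intros m' E E' K.
  assert (Z : forall z, wdist m z = wdist m' z)
    by (intros z; now rewrite !wdist_height0).
  rewrite (wdist_sym q m), Z, (wdist_sym m' q) in H1. rewrite Z in H2.
  rewrite (wdist_sym p m), Z, (wdist_sym m' p). now apply K. }
destruct q as [i q], r as [j r]. fold (bpt i q) (bpt j r) in *.
destruct (excluded_middle_informative (i = j)) as [e | n].
- subst j.
  assert (K : forall m, dist (Y i) q m = t * dist (Y i) q r ->
     dist (Y i) m r = (1 - t) * dist (Y i) q r ->
     wdist p (bpt i m) ^ 2 <= (1 - t) * wdist p (bpt i q) ^ 2
     + t * wdist p (bpt i r) ^ 2 - t * (1 - t) * wdist (bpt i q) (bpt i r) ^ 2).
  { clear m H1 H2 Nm Hmove. intros m H1 H2. destruct p as [k p]. fold (bpt k p).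
    destruct (excluded_middle_informative (k = i)) as [e | n].
    - subst k. rewrite !wdist_same. apply HY; assumption.
    - rewrite !(wdist_diff k i) by auto. rewrite wdist_same.
      apply gate_same_branch; auto using height_nonneg.
      + apply (stewart_convex _ (metric_pseudo _ (dist_metric (Y i))) (HY i)
          (pt (Y i)) q r m t); auto.
      + apply (HY i (pt (Y i)) q r m t); auto. }
  destruct m as [k m]. fold (bpt k m) in *.
  destruct (excluded_middle_informative (k = i)) as [e | n].
  + subst k. rewrite !wdist_same in H1, H2. apply K; assumption.
  + assert (Hm0 : height (bpt k m) = 0).
    { pose proof (wdist_le_height (bpt i q) (bpt i r)).
      rewrite (wdist_diff i k), (wdist_diff k i) in * by auto. lra. }
    apply (Hmove (bpt i (pt (Y i)))); auto using height_pt.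
    intros A B. rewrite !wdist_same in A, B. apply K; assumption.
- assert (K1 : forall m, wdist (bpt i q) (bpt i m) = t * wdist (bpt i q) (bpt j r) ->
     wdist (bpt i m) (bpt j r) = (1 - t) * wdist (bpt i q) (bpt j r) ->
     wdist p (bpt i m) ^ 2 <= (1 - t) * wdist p (bpt i q) ^ 2
     + t * wdist p (bpt j r) ^ 2 - t * (1 - t) * wdist (bpt i q) (bpt j r) ^ 2).
  { clear m H1 H2 Nm Hmove. intros m H1 H2. rewrite wdist_same, (wdist_diff i j q r n) in H1.
    rewrite (wdist_diff i j m r n), (wdist_diff i j q r n) in H2.
    apply stewart_gate_near; auto. }
  destruct m as [k m]. fold (bpt k m) in *.
  destruct (excluded_middle_informative (k = i)) as [e | n1].
  + subst k. apply K1; assumption.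
  + destruct (excluded_middle_informative (k = j)) as [e | n2].
    * subst k. rewrite (wdist_sym (bpt i q) (bpt j r)) in *.
      (* Mirror case, [m] in the branch of [r]: exchange [q] and [r] and replace [t] by [1 - t]. *)
      assert (K2 := stewart_gate_near j r m (bpt i q) p (1 - t)).
      rewrite wdist_sym, wdist_same in H2.
      rewrite (wdist_sym _ (bpt j m)) in H1. assert (n1' := not_eq_sym n).
      rewrite (wdist_diff j i r q n1') in H1, H2. rewrite (wdist_diff j i m q n1') in H1.
      specialize (K2 n ltac:(lra) H2 ltac:(lra)). lra.
    * assert (Hm0 : height (bpt k m) = 0).
      { rewrite (wdist_diff i k), (wdist_diff k j), (wdist_diff i j) in * by auto. lra. }
      apply (Hmove (bpt i (pt (Y i)))); auto using height_pt.
Qed.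

End Wedge.

(** * Radially truncated wedges: properness, geodesics and CAT(0) *)

Lemma radial_path (X : PMS) (HG : geodesic_space X) (z : car X) :
  exists g : R -> car X, g (dist X (pt X) z) = z /\
    (forall u, 0 <= u <= dist X (pt X) z -> dist X (pt X) (g u) = u) /\
    (forall u w, 0 <= u <= dist X (pt X) z -> 0 <= w <= dist X (pt X) z ->
       dist X (g u) (g w) = Rabs (u - w)).
Proof.
pose proof (pseudo_nonneg _ (metric_pseudo _ (dist_metric X)) (pt X) z) as Hz.
set (L := dist X (pt X) z) in *.
destruct (Rle_lt_dec L 0) as [H0 | H0].
- exists (fun _ => z). split; [reflexivity|]. split.
  + intros u Hu. change (L = u). lra.
  + intros u w Hu Hw. replace (u - w) with 0 by lra. rewrite Rabs_R0.
    apply (dist_metric X).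
- destruct (HG (pt X) z) as [g Hg].
  assert (range : forall u, 0 <= u <= L -> 0 <= u / L <= 1).
  { intros u Hu. split; [apply Rdiv_le_0_compat; lra|].
    apply Rmult_le_reg_r with L; [assumption|]. unfold Rdiv.
    rewrite Rmult_assoc, Rinv_l; lra. }
  exists (fun u => g (u / L)). split; [|split].
  + replace (L / L) with 1 by (field; lra). apply Hg.
  + intros u Hu. rewrite (geodesic_dist0 _ _ _ _ _ Hg) by auto.
    fold L. field. lra.
  + intros u w Hu Hw. destruct Hg as (_ & _ & Hg). rewrite Hg by auto. fold L.
    replace (u / L - w / L) with ((u - w) * / L) by (field; lra).
    rewrite Rabs_mult, (Rabs_pos_eq (/ L)) by (left; now apply Rinv_0_lt_compat).
    field. lra.
Qed.

Section TruncatedWedge.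

Context {I : Type} (Y : I -> PMS) (root : I) (rho : I -> R).
Context (rho_range : forall i, 0 <= rho i <= 1).

Notation height := (height Y).
Notation wdist := (wdist Y).
Notation bpt := (bpt Y).

(* [i]-th branch cut at radius [rho i / (1 - rho i)]; not cut when [rho i = 1]. *)
Definition in_radius (p : branch_pt Y) : Prop :=
  (1 - rho (projT1 p)) * height p <= rho (projT1 p).

(* The common base point is represented by that of the branch [root] only. *)
Definition trunc : Type :=
  {p : branch_pt Y | in_radius p /\ (height p = 0 -> projT1 p = root)}.

Definition tdist (a b : trunc) : R := wdist (proj1_sig a) (proj1_sig b).

Lemma tdist_metric : is_metric tdist.
Proof.
destruct (wdist_pseudo Y) as (d0 & ds & dt).
split; [|split; [|split]]; unfold tdist; auto.
intros [p [p1 p2]] [q [q1 q2]] E; simpl in E.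
cut (p = q). { intros <-. f_equal. apply proof_irrelevance. }
clear p1 q1. destruct p as [i z], q as [j w]. fold (bpt i z) (bpt j w) in *.
destruct (excluded_middle_informative (i = j)) as [e | n].
- subst j. rewrite wdist_same in E. f_equal. now apply (dist_metric (Y i)).
- rewrite wdist_diff in E by assumption.
  pose proof (height_nonneg Y (bpt i z)). pose proof (height_nonneg Y (bpt j w)).
  simpl in p2, q2. rewrite p2, q2 in n by lra. now destruct n.
Qed.

Lemma wdist_zero_eq p q : wdist p q = 0 -> forall z, wdist p z = wdist q z.
Proof.
destruct (wdist_pseudo Y) as (d0 & ds & dt).
intros E z. pose proof (dt p q z). pose proof (dt q p z). rewrite (ds q p) in *. lra.
Qed.

Lemma in_radius_root : in_radius (bpt root (pt (Y root))).
Proof. unfold in_radius. rewrite height_pt. simpl. specialize (rho_range root). lra. Qed.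

Definition tpt : trunc := exist _ (bpt root (pt (Y root)))
  (conj in_radius_root (fun _ => eq_refl)).

Lemma tdist_tpt a : tdist tpt a = height (proj1_sig a).
Proof. apply wdist_pt. Qed.

Lemma trunc_rep p : in_radius p -> exists a : trunc, wdist (proj1_sig a) p = 0.
Proof.
intros Hp. destruct (Req_dec (height p) 0) as [E | E].
- exists tpt. simpl. now rewrite wdist_pt.
- exists (exist _ p (conj Hp (fun e => False_ind _ (E e)))). apply wdist_pseudo.
Qed.

Context (rho_vanish : forall r, 0 < r -> exists l : list I,
  forall p, in_radius p -> ~ In (projT1 p) l -> height p < r).

(** Height at least [r] keeps away from the base point, the one point that may be represented in
    another branch. What remains of [A] on branch [i] is closed and bounded in a proper space. *)
Lemma trunc_branch_compact (J : Type) (U : J -> trunc -> Prop) (A : trunc -> Prop) r i :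
  (forall j, mopen tdist (U j)) -> (forall x, A x -> exists j, U j x) ->
  mclosed tdist A -> mbounded tdist A -> 0 < r ->
  exists l : list J, forall a, A a -> projT1 (proj1_sig a) = i ->
    r <= height (proj1_sig a) -> exists j, In j l /\ U j a.
Proof.
intros HU HAU HA HAb Hr.
destruct (wdist_pseudo Y) as (d0 & ds & dt).
pose (B := fun z => exists H, A (exist _ (bpt i z) H) /\ r <= height (bpt i z)).
assert (HB : mcompact (dist (Y i)) B).
{ apply (dist_proper (Y i)).
  - intros z Hz.
    destruct (Rlt_le_dec (height (bpt i z)) r) as [Hlt | Hge].
    + exists (r - height (bpt i z)). split; [lra|]. intros w Hw (H & _ & Hc).
      pose proof (height_lip Y (bpt i z) (bpt i w)). rewrite wdist_same in *. lra.
    + destruct (Rle_lt_dec ((1 - rho i) * height (bpt i z)) (rho i)) as [Hin | Hout].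
      * assert (Hz' : in_radius (bpt i z) /\ (height (bpt i z) = 0 -> i = root))
          by (split; [assumption | lra]).
        destruct (HA (exist _ (bpt i z) Hz')) as (e & He & Hball).
        { intros Ha. apply Hz. now exists Hz'. }
        exists e. split; [assumption|]. intros w Hw (H & Ha & _).
        apply (Hball (exist _ (bpt i w) H)); [|assumption].
        unfold tdist; simpl. now rewrite wdist_same.
      * exists ((1 - rho i) * height (bpt i z) - rho i). split; [lra|].
        intros w Hw ((H & _) & _ & _). unfold in_radius in H; simpl in H.
        pose proof (height_lip Y (bpt i w) (bpt i z)). rewrite ds, wdist_same in *.
        specialize (rho_range i).
        assert (0 <= dist (Y i) z w)
          by apply pseudo_nonneg, metric_pseudo, (dist_metric (Y i)).
        nra.
  - destruct HAb as (x & R0 & Hb).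
    exists (pt (Y i)), (height (proj1_sig x) + R0). intros z (H & Ha & _).
    apply Hb in Ha. pose proof (height_lip Y (proj1_sig x) (bpt i z)) as K.
    unfold tdist in Ha; simpl in Ha. unfold height at 1 in K; simpl in K. lra. }
(* The sets [U j] live on the truncation only. They are replaced by open sets of the whole branch:
   the points having a ball around them whose trace on the truncation lies in [U j]. *)
destruct (HB J (fun j z => exists e, 0 < e /\ forall a : trunc,
   wdist (bpt i z) (proj1_sig a) < e -> U j a)) as [l Hl].
- intros j z (e & He & Hball). exists (e / 2). split; [lra|].
  intros w Hw. exists (e / 2). split; [lra|]. intros a Ha. apply Hball.
  pose proof (dt (bpt i z) (bpt i w) (proj1_sig a)). rewrite wdist_same in H. lra.
- intros z (H & Ha & _). destruct (HAU _ Ha) as [j Hj]. exists j.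
  destruct (HU j _ Hj) as (e & He & Hball). exists e. split; [assumption|].
  intros a. apply (Hball a).
- exists l. intros [[k z] H] Ha Hk Hh. simpl in Hk, Hh. subst k.
  destruct (Hl z) as (j & Hj & e & He & Hball); [now exists H|].
  exists j. split; [assumption|]. apply Hball. simpl. fold (bpt i z). now rewrite d0.
Qed.

(** A ball around the base point is either inside one open set of the cover or disjoint from [A].
    Outside it [rho_vanish] leaves finitely many branches, each settled by
    [trunc_branch_compact]. *)
Lemma tdist_proper : mproper tdist.
Proof.
intros A HA HAb J U HU HAU.
assert (Hsmall : exists r, 0 < r /\ exists l : list J,
  forall a, A a -> height (proj1_sig a) < r -> exists j, In j l /\ U j a).
{ destruct (classic (A tpt)) as [Ho | Ho].
  - destruct (HAU _ Ho) as [j Hj]. destruct (HU j _ Hj) as (r & Hr & Hball).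
    exists r. split; [assumption|]. exists [j]. intros a _ Ha. exists j.
    split; [now left|]. apply Hball. now rewrite tdist_tpt.
  - destruct (HA _ Ho) as (r & Hr & Hball).
    exists r. split; [assumption|]. exists []. intros a HAa Ha.
    exfalso. apply (Hball a); [now rewrite tdist_tpt | assumption]. }
destruct Hsmall as (r & Hr & l0 & Hl0).
destruct (rho_vanish r Hr) as [li Hli].
assert (Hlist : forall li : list I, exists l : list J, forall a, A a ->
   In (projT1 (proj1_sig a)) li -> r <= height (proj1_sig a) ->
   exists j, In j l /\ U j a).
{ clear li Hli. intros li. induction li as [|i li [l IH]].
  - exists []. intros a _ [].
  - destruct (trunc_branch_compact J U A r i) as [l' Hl']; auto.
    exists (l' ++ l). intros a Ha [Hi | Hi] Hh.
    + destruct (Hl' a) as (j & Hj & Hu); auto. exists j. rewrite in_app_iff. auto.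
    + destruct (IH a) as (j & Hj & Hu); auto. exists j. rewrite in_app_iff. auto. }
destruct (Hlist li) as [l Hl].
exists (l0 ++ l). intros a Ha.
destruct (Rlt_le_dec (height (proj1_sig a)) r) as [H | H].
- destruct (Hl0 a) as (j & Hj & Hu); auto. exists j. rewrite in_app_iff. auto.
- destruct (classic (In (projT1 (proj1_sig a)) li)) as [Hi | Hi].
  + destruct (Hl a) as (j & Hj & Hu); auto. exists j. rewrite in_app_iff. auto.
  + specialize (Hli (proj1_sig a) (proj1 (proj2_sig a)) Hi). lra.
Qed.

Definition trunc_PMS : PMS := {|
  car := trunc; dist := tdist; pt := tpt;
  dist_metric := tdist_metric; dist_proper := tdist_proper |}.

(** A path in the untruncated wedge may run through base points that are not the chosen
    representative; replacing each of its points by one at distance 0 does not alter distances. *)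
Lemma trunc_geodesic_path (x y : trunc) (path : R -> branch_pt Y) :
  wdist (path 0) (proj1_sig x) = 0 -> wdist (path 1) (proj1_sig y) = 0 ->
  (forall s, 0 <= s <= 1 -> in_radius (path s)) ->
  (forall s t, 0 <= s <= 1 -> 0 <= t <= 1 ->
     wdist (path s) (path t) = Rabs (s - t) * tdist x y) ->
  exists g, geodesic_between trunc_PMS x y g.
Proof.
intros H0 H1 Hin Hd.
destruct (wdist_pseudo Y) as (d0 & ds & dt).
assert (C : forall s, exists a : trunc, 0 <= s <= 1 -> wdist (proj1_sig a) (path s) = 0).
{ intros s. destruct (classic (0 <= s <= 1)) as [Hs | Hs].
  - destruct (trunc_rep (path s)) as [a Ha]; auto. now exists a.
  - exists tpt. tauto. }
set (g s := proj1_sig (constructive_indefinite_description _ (C s))).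
assert (Hg : forall s, 0 <= s <= 1 -> wdist (proj1_sig (g s)) (path s) = 0)
  by (intros s; exact (proj2_sig (constructive_indefinite_description _ (C s)))).
exists g. destruct tdist_metric as (_ & sep & _ & _). split; [|split].
- apply sep. unfold tdist. rewrite (wdist_zero_eq _ (path 0)); auto. apply Hg; lra.
- apply sep. unfold tdist. rewrite (wdist_zero_eq _ (path 1)); auto. apply Hg; lra.
- intros s t Hs Ht. simpl. unfold tdist at 1.
  rewrite (wdist_zero_eq _ (path s)), ds, (wdist_zero_eq _ (path t)), ds; auto.
Qed.

Context (HY : forall i, CAT0 (Y i)).

Lemma in_radius_le i z h : in_radius (bpt i z) ->
  forall w, height (bpt i w) <= h -> h <= height (bpt i z) -> in_radius (bpt i w).
Proof.
unfold in_radius; simpl. intros H w H1 H2. specialize (rho_range i). nra.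
Qed.

(** Within a branch, convexity of the height keeps a geodesic inside the cut. Between two branches,
    the two radial geodesics are joined at the base point. *)
Lemma trunc_geodesic : geodesic_space trunc_PMS.
Proof.
intros [[i z] [Hz Hz0]] [[j w] [Hw Hw0]].
fold (bpt i z) (bpt j w) in *.
destruct (wdist_pseudo Y) as (d0 & ds & dt).
destruct (excluded_middle_informative (i = j)) as [e | n].
- subst j. destruct (proj1 (HY i) z w) as [g Hg].
  apply (trunc_geodesic_path _ _ (fun s => bpt i (g s))); simpl.
  + destruct Hg as (-> & _ & _). apply d0.
  + destruct Hg as (_ & -> & _). apply d0.
  + intros s Hs.
    pose proof (stewart_convex _ (metric_pseudo _ (dist_metric (Y i)))
      (CAT0_stewart _ (HY i)) (pt (Y i)) z w (g s) s Hs
      (geodesic_dist0 _ _ _ _ _ Hg Hs) (geodesic_dist1 _ _ _ _ _ Hg Hs)) as K.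
    unfold in_radius in *; simpl in *.
    change (height (bpt i (g s))) with (dist (Y i) (pt (Y i)) (g s)).
    change (height (bpt i z)) with (dist (Y i) (pt (Y i)) z) in Hz.
    change (height (bpt i w)) with (dist (Y i) (pt (Y i)) w) in Hw.
    specialize (rho_range i).
    apply Rmult_le_compat_l with (r := 1 - rho i) in K; [|lra]. nra.
  + intros s t Hs Ht. unfold tdist; simpl. rewrite !wdist_same. now apply Hg.
- destruct (radial_path (Y i) (proj1 (HY i)) z) as (g1 & E1 & h1 & D1).
  destruct (radial_path (Y j) (proj1 (HY j)) w) as (g2 & E2 & h2 & D2).
  change (dist (Y i) (pt (Y i)) z) with (height (bpt i z)) in *.
  change (dist (Y j) (pt (Y j)) w) with (height (bpt j w)) in *.
  pose proof (height_nonneg Y (bpt i z)) as Nz.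
  pose proof (height_nonneg Y (bpt j w)) as Nw.
  set (a := height (bpt i z)) in *. set (b := height (bpt j w)) in *.
  (* signed arc length measured from the base point *)
  set (branch u := if Rle_lt_dec 0 u then bpt i (g1 u) else bpt j (g2 (- u))).
  assert (Hbranch : forall u v, - b <= u <= a -> - b <= v <= a ->
    wdist (branch u) (branch v) = Rabs (u - v)).
  { intros u v Hu Hv. unfold branch.
    destruct (Rle_lt_dec 0 u), (Rle_lt_dec 0 v).
    - rewrite wdist_same, D1; auto; lra.
    - rewrite wdist_diff by auto. unfold height; simpl. rewrite h1, h2 by lra.
      rewrite Rabs_pos_eq; lra.
    - rewrite wdist_diff by auto. unfold height; simpl. rewrite h1, h2 by lra.
      rewrite Rabs_left1; lra.
    - rewrite wdist_same, D2 by lra.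
      rewrite <- Rabs_Ropp. f_equal. ring. }
  assert (Ha : wdist (branch a) (bpt i z) = 0).
  { unfold branch. destruct (Rle_lt_dec 0 a); [rewrite E1; apply d0 | lra]. }
  assert (Hb : wdist (branch (- b)) (bpt j w) = 0).
  { unfold branch. destruct (Rle_lt_dec 0 (- b)).
    - assert (Eb : b = 0) by lra. rewrite Eb, Ropp_0.
      rewrite wdist_diff by auto. fold b. unfold height; simpl. rewrite h1 by lra. lra.
    - rewrite Ropp_involutive, E2. apply d0. }
  apply (trunc_geodesic_path _ _ (fun s => branch (a - s * (a + b)))); simpl.
  + now replace (a - 0 * (a + b)) with a by ring.
  + now replace (a - 1 * (a + b)) with (- b) by ring.
  + intros s Hs. unfold branch. destruct (Rle_lt_dec 0 (a - s * (a + b))).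
    * apply (in_radius_le i z (a - s * (a + b)) Hz); [|fold a; nra].
      unfold height; simpl. rewrite h1; [lra | nra].
    * apply (in_radius_le j w (- (a - s * (a + b))) Hw); [|fold b; nra].
      unfold height; simpl. rewrite h2; [lra | nra].
  + intros s t Hs Ht. rewrite Hbranch by nra. unfold tdist; simpl.
    rewrite wdist_diff by auto. fold a b.
    replace (a - s * (a + b) - (a - t * (a + b))) with (- ((s - t) * (a + b))) by ring.
    rewrite Rabs_Ropp, Rabs_mult, (Rabs_pos_eq (a + b)) by lra. reflexivity.
Qed.

Lemma trunc_CAT0 : CAT0 trunc_PMS.
Proof.
apply stewart_CAT0; [apply trunc_geodesic|].
intros p q r m t. apply (wdist_stewart Y (fun i => CAT0_stewart _ (HY i))).
Qed.

End TruncatedWedge.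

(** * Closeness at a fixed scale and its relation to the pointed Gromov-Hausdorff distance *)

(* Values [h (inl x) (inr y)] of a metric [h] extending those of [X] and [Y]. *)
Definition cross_metric (X Y : PMS) (c : car X -> car Y -> R) : Prop :=
  (forall x y, 0 < c x y) /\
  (forall x x' y, c x y <= dist X x x' + c x' y) /\
  (forall x y y', c x y <= c x y' + dist Y y' y) /\
  (forall x x' y, dist X x x' <= c x y + c x' y) /\
  (forall x y y', dist Y y y' <= c x y + c x y').

(** Continuity and separation are argued on this relation; the infimum and the cap [/ 2] of [GHstar]
    are confined to the conversions [close_GHstar] and [GHstar_close]. *)
Definition close (X Y : PMS) (t : R) : Prop :=
  exists c, cross_metric X Y c /\ c (pt X) (pt Y) < t /\
    (forall x, dist X (pt X) x <= / t -> exists y, c x y < t) /\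
    (forall y, dist Y (pt Y) y <= / t -> exists x, c x y < t).

Lemma close_pos X Y t : close X Y t -> 0 < t.
Proof. intros (c & (Hc & _) & H & _). specialize (Hc (pt X) (pt Y)). lra. Qed.

Lemma close_admissible X Y t : close X Y t <-> 0 < t /\ exists h, admissible X Y t h.
Proof.
split.
- intros H. split; [exact (close_pos _ _ _ H)|].
  pose proof (close_pos _ _ _ H) as Ht.
  destruct H as (c & (C0 & C1 & C2 & C3 & C4) & Hp & HX & HY).
  destruct (dist_metric X) as (x0 & xsep & xs & xt).
  destruct (dist_metric Y) as (y0 & ysep & ys & yt).
  exists (fun p q => match p, q with
    | inl x, inl x' => dist X x x' | inr y, inr y' => dist Y y y'
    | inl x, inr y => c x y | inr y, inl x => c x y end).
  split; [|split; [|split; [|split; [|split]]]]; auto.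
  + split; [|split; [|split]].
    * intros [x | y]; auto.
    * intros [x | y] [x' | y'] E; try (f_equal; auto; fail);
        [specialize (C0 x y') | specialize (C0 x' y)]; lra.
    * intros [x | y] [x' | y']; auto.
    * intros [x | y] [x' | y'] [x'' | y'']; auto.
      -- specialize (C1 x'' x' y). rewrite xs in C1. lra.
      -- specialize (C2 x'' y y'). rewrite ys in C2. lra.
  + intros [x | y] Hz; [now apply HX|]. exists y. rewrite y0. assumption.
  + intros [x | y] Hz; [|now apply HY]. exists x. rewrite x0. assumption.
- intros (Ht & h & (h0 & hsep & hs & ht) & Hx & Hy & Hp & HX & HY).
  exists (fun x y => h (inl x) (inr y)).
  split; [|split; [assumption | split]].
  + split; [|split; [|split; [|split]]]; intros.
    * assert (Hn : 0 <= h (inl x) (inr y)) by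
        (apply pseudo_nonneg; repeat split; assumption).
      destruct (Req_dec (h (inl x) (inr y)) 0) as [E | E]; [|lra].
      apply hsep in E. discriminate.
    * rewrite <- Hx. apply ht.
    * rewrite <- Hy. apply ht.
    * rewrite <- Hx, (hs (inl x')). apply ht.
    * rewrite <- Hy, (hs (inl x) (inr y)). apply ht.
  + intros x H. apply HX. now rewrite Hx.
  + intros y H. destruct (HY (inr y)) as [x E]; [now rewrite Hy|].
    exists x. now rewrite hs.
Qed.

Lemma close_sym X Y t : close X Y t -> close Y X t.
Proof.
intros (c & (C0 & C1 & C2 & C3 & C4) & Hp & HX & HY).
destruct (dist_metric X) as (_ & _ & xs & _).
destruct (dist_metric Y) as (_ & _ & ys & _).
exists (fun y x => c x y). split; [|auto].
split; [|split; [|split; [|split]]]; intros; auto.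
- rewrite Rplus_comm, ys. auto.
- rewrite Rplus_comm, xs. auto.
Qed.

Lemma close_mono X Y t t' : t <= t' -> close X Y t -> close X Y t'.
Proof.
intros Ht H. pose proof (close_pos _ _ _ H) as H0.
destruct H as (c & C & Hp & HX & HY).
assert (/ t' <= / t) by (apply Rinv_le_contravar; lra).
exists c. split; [assumption|]. split; [lra|].
split; intros z Hz; [destruct (HX z) as [y Hy] | destruct (HY z) as [y Hy]];
  try lra; exists y; lra.
Qed.

Lemma infimum_exists {T : Type} (t0 : T) (f : T -> R) (Hf : forall t, 0 <= f t) :
  exists m, (forall t, m <= f t) /\ forall e, 0 < e -> exists t, f t < m + e.
Proof.
destruct (completeness (fun r => exists t, r = - f t)) as [s [Hub Hlub]].
- exists 0. intros r [t ->]. specialize (Hf t). lra.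
- now exists (- f t0), t0.
- exists (- s). split.
  + intros t. assert (- f t <= s) by (apply Hub; now exists t). lra.
  + intros e He. apply NNPP. intros Hn.
    assert (s <= s - e); [|lra].
    apply Hlub. intros r [t ->]. apply Rnot_lt_le. intros Hlt.
    apply Hn. exists t. lra.
Qed.

(** Gluing along [Y]: the cross distance is the infimum over [Y] of the two-step distances, raised
    by a small constant to make it positive. *)
Lemma close_trans X Y Z t1 t2 t : t1 <= / 2 -> t2 <= / 2 -> t1 + t2 < t ->
  close X Y t1 -> close Y Z t2 -> close X Z t.
Proof.
intros Ht1 Ht2 Ht H1 H2.
pose proof (close_pos _ _ _ H1) as P1. pose proof (close_pos _ _ _ H2) as P2.
destruct H1 as (c & (C0 & C1 & C2 & C3 & C4) & Hp & HX & HY).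
destruct H2 as (k & (K0 & K1 & K2 & K3 & K4) & Kp & KY & KZ).
destruct (dist_metric X) as (_ & _ & xs & xt).
destruct (dist_metric Y) as (_ & _ & ys & yt).
destruct (dist_metric Z) as (_ & _ & zs & zt).
assert (Inf : forall x z, exists m, (forall y, m <= c x y + k y z) /\
  forall e, 0 < e -> exists y, c x y + k y z < m + e).
{ intros x z. apply (infimum_exists (pt Y)). intros y.
  specialize (C0 x y). specialize (K0 y z). lra. }
set (m x z := proj1_sig (constructive_indefinite_description _ (Inf x z))).
assert (m1 : forall x z y, m x z <= c x y + k y z)
  by (intros x z; apply (proj2_sig (constructive_indefinite_description _ (Inf x z)))).
assert (m2 : forall x z e, 0 < e -> exists y, c x y + k y z < m x z + e)
  by (intros x z; apply (proj2_sig (constructive_indefinite_description _ (Inf x z)))).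
assert (m0 : forall x z, 0 <= m x z).
{ intros x z. apply le_epsilon. intros e He. destruct (m2 x z e He) as [y Hy].
  specialize (C0 x y). specialize (K0 y z). lra. }
clearbody m.
(* A point of the ball of radius [/ t] in X is matched with a point of Y at distance at most
   [2 * t1 + / t] from the base point, and that point must be in range of the second closeness. The
   condition amounts to [2 * t2 * (t1 + t2) <= 1], hence the bounds by [/ 2]. *)
assert (inv1 : 2 * t1 + / t <= / t2 /\ 2 * t2 + / t <= / t1).
{ assert (Hs : / t <= / (t1 + t2)) by (apply Rinv_le_contravar; lra).
  split; (eapply Rle_trans; [apply Rplus_le_compat_l, Hs|]);
    match goal with |- ?l <= ?r => cut (0 <= r - l); [lra|] end.
  - replace (/ t2 - (2 * t1 + / (t1 + t2)))
      with (t1 * (1 - 2 * (t2 * (t1 + t2))) / (t2 * (t1 + t2))) by (field; lra).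
    apply Rdiv_le_0_compat; [|nra]. apply Rmult_le_pos; nra.
  - replace (/ t1 - (2 * t2 + / (t1 + t2)))
      with (t2 * (1 - 2 * (t1 * (t1 + t2))) / (t1 * (t1 + t2))) by (field; lra).
    apply Rdiv_le_0_compat; [|nra]. apply Rmult_le_pos; nra. }
destruct inv1 as [inv1 inv2].
assert (it1 : / t <= / t1) by lra. assert (it2 : / t <= / t2) by lra.
set (d := (t - t1 - t2) / 2).
exists (fun x z => m x z + d). unfold d. split; [|split; [|split]].
- split; [|split; [|split; [|split]]]; intros.
  + specialize (m0 x y). lra.
  + cut (m x y <= dist X x x' + m x' y); [lra|]. apply le_epsilon. intros e He.
    destruct (m2 x' y e He) as [w Hw]. specialize (m1 x y w). specialize (C1 x x' w). lra.
  + cut (m x y <= m x y' + dist Z y' y); [lra|]. apply le_epsilon. intros e He.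
    destruct (m2 x y' e He) as [w Hw]. specialize (m1 x y w). specialize (K2 w y y'). lra.
  + cut (dist X x x' <= m x y + m x' y); [lra|]. apply le_epsilon. intros e He.
    destruct (m2 x y (e / 2)) as [w Hw]; [lra|].
    destruct (m2 x' y (e / 2)) as [w' Hw']; [lra|].
    specialize (K3 w w' y). specialize (C2 x w' w). specialize (C3 x x' w').
    lra.
  + cut (dist Z y y' <= m x y + m x y'); [lra|]. apply le_epsilon. intros e He.
    destruct (m2 x y (e / 2)) as [w Hw]; [lra|].
    destruct (m2 x y' (e / 2)) as [w' Hw']; [lra|].
    specialize (C4 x w w'). specialize (K4 w y y').
    specialize (K1 w w' y'). lra.
- specialize (m1 (pt X) (pt Z) (pt Y)). lra.
- intros x Hx. destruct (HX x) as [y Hy]; [lra|].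
  destruct (KY y) as [z Hz].
  { specialize (C4 x (pt Y) y). specialize (C1 x (pt X) (pt Y)). rewrite xs in C1. lra. }
  exists z. specialize (m1 x z y). lra.
- intros z Hz. destruct (KZ z) as [y Hy]; [lra|].
  destruct (HY y) as [x Hx].
  { specialize (K3 (pt Y) y z). specialize (K2 (pt Y) z (pt Z)). lra. }
  exists x. specialize (m1 x z y). lra.
Qed.

Lemma pointed_isometric_close X Y t : 0 < t -> pointed_isometric X Y -> close X Y t.
Proof.
intros Ht (f & Hf & Hs & Hpt).
destruct (metric_pseudo _ (dist_metric Y)) as (y0 & ys & yt).
pose proof (pseudo_nonneg _ (metric_pseudo _ (dist_metric Y))) as yn.
exists (fun x y => dist Y (f x) y + t / 2). split; [|split; [|split]].
- split; [|split; [|split; [|split]]]; intros.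
  + specialize (yn (f x) y). lra.
  + rewrite <- Hf. specialize (yt (f x) (f x') y). lra.
  + specialize (yt (f x) y' y). lra.
  + rewrite <- Hf. specialize (yt (f x) y (f x')). rewrite (ys y) in yt. lra.
  + specialize (yt y (f x) y'). rewrite (ys y (f x)) in yt. lra.
- rewrite Hpt, y0. lra.
- intros x _. exists (f x). rewrite y0. lra.
- intros y _. destruct (Hs y) as [x <-]. exists x. rewrite y0. lra.
Qed.

Lemma close_GHstar X Y t : close X Y t -> GHstar X Y <= t.
Proof.
intros H. apply close_admissible in H.
unfold GHstar, GHprime.
destruct (Glb_Rbar_correct (fun t => 0 < t /\ exists h, admissible X Y t h)) as [Hlb Hglb].
set (g := Glb_Rbar _) in *.
assert (Hg : Rbar_le g t) by (apply Hlb; exact H).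
assert (H0 : Rbar_le 0 g) by (apply Hglb; intros s [Hs _]; simpl; lra).
destruct g as [g | |]; simpl in *; try tauto.
unfold Rbar_min; simpl. apply Rle_trans with g; [apply Rmin_l | assumption].
Qed.

(** As [e <= / 2], the cap cannot be what makes [GHstar] smaller than [e], so the infimum itself is
    below [e]. *)
Lemma GHstar_close X Y e : e <= / 2 -> GHstar X Y < e -> exists t, t < e /\ close X Y t.
Proof.
intros He H. apply NNPP. intros Hn.
unfold GHstar, GHprime in H.
destruct (Glb_Rbar_correct (fun t => 0 < t /\ exists h, admissible X Y t h)) as [Hlb Hglb].
set (g := Glb_Rbar _) in *.
assert (H0 : Rbar_le e g).
{ apply Hglb. intros s Hs. simpl. apply Rnot_lt_le. intros Hlt. apply Hn.
  exists s. split; [assumption|]. now apply close_admissible. }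
destruct g as [g | |]; unfold Rbar_min in H; simpl in *; try tauto; try lra.
revert H. apply Rle_not_lt. apply Rmin_glb; assumption.
Qed.

(** * Dependence of the truncated wedge on the radii *)

Section TruncatedWedgeDistance.

Context {I : Type} (Y : I -> PMS) (root : I) (HY : forall i, CAT0 (Y i)).

(** The cut reads (1-r)(1+u) <= 1 at height u, and k = t/(1+t) is the inverse of 1 + 1/t. If 1-r' <=
    k, the new cut spares the whole ball of radius [/ t]. Otherwise descending by t/4 gains at least
    k t/4, while the change of parameter costs at most k^2 (t/4)(1 + 1/t) = k t/4. *)
Lemma truncation_point (t r r' : R) (X : PMS) (z : car X) : CAT0 X -> 0 < t ->
  0 <= r <= 1 -> 0 <= r' <= 1 -> Rabs (r' - r) <= (t / (1 + t)) ^ 2 * t / 4 ->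
  (1 - r) * dist X (pt X) z <= r -> dist X (pt X) z <= / t ->
  exists w, dist X z w < t / 2 /\ (1 - r') * dist X (pt X) w <= r'.
Proof.
intros HX Ht Hr Hr' Hrr Hz Hzt.
pose proof (pseudo_nonneg _ (metric_pseudo _ (dist_metric X)) (pt X) z) as Hn.
destruct (metric_pseudo _ (dist_metric X)) as (x0 & xs & xt).
destruct (radial_path X (proj1 HX) z) as (g & Eg & h & D).
set (u := dist X (pt X) z) in *.
set (k := t / (1 + t)) in *.
assert (Hk : k * (1 + / t) = 1) by (unfold k; field; lra).
assert (Hk0 : 0 < k) by (apply Rdiv_lt_0_compat; lra).
destruct (Rle_lt_dec (1 - r') k) as [Hc | Hc].
- exists z. rewrite x0. split; [lra|]. fold u.
  assert ((1 - r') * (1 + u) <= 1); [|lra].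
  rewrite <- Hk. apply Rmult_le_compat; lra.
- destruct (Rle_lt_dec u (t / 4)) as [Hu | Hu].
  + exists (pt X). rewrite xs, x0. fold u. split; lra.
  + exists (g (u - t / 4)). rewrite h by lra. rewrite <- Eg at 1. rewrite D by lra.
    split; [rewrite Rabs_pos_eq; lra|].
    apply Rabs_le_between in Hrr.
    assert (k ^ 2 * t / 4 * (1 + u) <= k * t / 4).
    { apply Rle_trans with (k ^ 2 * t / 4 * (1 + / t)).
      - apply Rmult_le_compat_l; [|lra]. assert (0 < k ^ 2) by nra. nra.
      - apply Req_le. replace (k ^ 2 * t / 4 * (1 + / t)) with (k * t / 4 * (k * (1 + / t)))
          by (field; lra). rewrite Hk. ring. }
    assert ((r - r') * (1 + u) <= k ^ 2 * t / 4 * (1 + u))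
      by (apply Rmult_le_compat_r; lra).
    assert (k * (t / 4) <= (1 - r') * (t / 4)) by (apply Rmult_le_compat_r; lra).
    nra.
Qed.

Context (rho rho' : I -> R).
Context (rho_range : forall i, 0 <= rho i <= 1).
Context (rho'_range : forall i, 0 <= rho' i <= 1).
Context (rho_vanish : forall r, 0 < r -> exists l : list I,
  forall p, in_radius Y rho p -> ~ In (projT1 p) l -> height Y p < r).
Context (rho'_vanish : forall r, 0 < r -> exists l : list I,
  forall p, in_radius Y rho' p -> ~ In (projT1 p) l -> height Y p < r).

Notation W := (trunc_PMS Y root rho rho_range rho_vanish).
Notation W' := (trunc_PMS Y root rho' rho'_range rho'_vanish).

(** Both truncations sit in the same wedge, whose distance serves as cross distance. The shift by
    [t / 2] makes it positive and leaves [t / 2] for the displacement given by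
    [truncation_point]. *)
Lemma trunc_close t : 0 < t ->
  (forall i, Rabs (rho i - rho' i) <= (t / (1 + t)) ^ 2 * t / 4) -> close W W' t.
Proof.
intros Ht Hrr.
destruct (wdist_pseudo Y) as (d0 & ds & dt).
pose proof (pseudo_nonneg _ (wdist_pseudo Y)) as dn.
exists (fun x y => wdist Y (proj1_sig x) (proj1_sig y) + t / 2).
split; [|split; [|split]].
- split; [|split; [|split; [|split]]]; simpl; unfold tdist; intros.
  + specialize (dn (proj1_sig x) (proj1_sig y)). lra.
  + specialize (dt (proj1_sig x) (proj1_sig x') (proj1_sig y)). lra.
  + specialize (dt (proj1_sig x) (proj1_sig y') (proj1_sig y)). lra.
  + specialize (dt (proj1_sig x) (proj1_sig y) (proj1_sig x')).
    rewrite (ds (proj1_sig y) (proj1_sig x')) in dt. lra.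
  + specialize (dt (proj1_sig y) (proj1_sig x) (proj1_sig y')).
    rewrite (ds (proj1_sig y) (proj1_sig x)) in dt. lra.
- simpl. rewrite d0. lra.
- intros [[i z] [Hz Hz0]] Hx. simpl in Hx. rewrite tdist_tpt in Hx. simpl in Hx.
  destruct (truncation_point t (rho i) (rho' i) (Y i) z) as (w & Hw & Hw'); auto.
  { rewrite Rabs_minus_sym. apply Hrr. }
  destruct (trunc_rep Y root rho' rho'_range (bpt Y i w)) as [a Ha]; [exact Hw'|].
  exists a. simpl. fold (bpt Y i z).
  rewrite ds, (wdist_zero_eq Y _ _ Ha), wdist_same, (proj1 (proj2 (metric_pseudo _ (dist_metric (Y i))))).
  lra.
- intros [[i z] [Hz Hz0]] Hx. simpl in Hx. rewrite tdist_tpt in Hx. simpl in Hx.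
  destruct (truncation_point t (rho' i) (rho i) (Y i) z) as (w & Hw & Hw'); auto.
  destruct (trunc_rep Y root rho rho_range (bpt Y i w)) as [a Ha]; [exact Hw'|].
  exists a. simpl. fold (bpt Y i z).
  rewrite (wdist_zero_eq Y _ _ Ha), wdist_same, (proj1 (proj2 (metric_pseudo _ (dist_metric (Y i))))).
  lra.
Qed.

(** Radius 0 keeps only base points, so every point of the wedge is at distance 0 from a point of
    branch [j], even when [root] is another branch; choosing such a point gives the isometry. *)
Lemma trunc_single_branch j : rho j = 1 -> (forall i, i <> j -> rho i = 0) ->
  pointed_isometric W (Y j).
Proof.
intros Hj Hi.
destruct (wdist_pseudo Y) as (d0 & ds & dt).
assert (C : forall a : trunc Y root rho, exists z, wdist Y (proj1_sig a) (bpt Y j z) = 0).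
{ intros [[i z] [Hz Hz']]. simpl. unfold in_radius in Hz; simpl in Hz.
  destruct (excluded_middle_informative (i = j)) as [e | n].
  - subst i. exists z. apply d0.
  - exists (pt (Y j)). rewrite ds, wdist_pt. rewrite (Hi i n) in Hz.
    pose proof (height_nonneg Y (existT _ i z)). lra. }
set (f a := proj1_sig (constructive_indefinite_description _ (C a))).
assert (Hf : forall a, wdist Y (proj1_sig a) (bpt Y j (f a)) = 0)
  by (intros a; exact (proj2_sig (constructive_indefinite_description _ (C a)))).
clearbody f. exists f. split; [|split].
- intros a b. simpl. unfold tdist.
  rewrite <- (wdist_same Y j), (wdist_zero_eq Y _ _ (Hf a)), ds.
  rewrite <- (wdist_zero_eq Y _ _ (Hf b)), ds. reflexivity.
- intros z. destruct (trunc_rep Y root rho rho_range (bpt Y j z)) as [a Ha].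
  { unfold in_radius; simpl. rewrite Hj. lra. }
  exists a. apply (dist_metric (Y j)).
  rewrite <- (wdist_same Y j), <- (wdist_zero_eq Y _ _ (Hf a)). exact Ha.
- apply (dist_metric (Y j)).
  rewrite <- (wdist_same Y j), <- (wdist_zero_eq Y _ _ (Hf _)). simpl.
  rewrite wdist_pt. apply height_pt.
Qed.

End TruncatedWedgeDistance.

(** * The real line as a pointed proper CAT(0) space *)

Lemma Rabs_dist_metric : is_metric (fun x y : R => Rabs (x - y)).
Proof.
split; [|split; [|split]].
- intros x. rewrite Rminus_diag. apply Rabs_R0.
- intros x y E. destruct (Req_dec (x - y) 0) as [E' | E']; [lra|].
  now apply Rabs_no_R0 in E'.
- apply Rabs_minus_sym.
- intros x y z. replace (x - z) with ((x - y) + (y - z)) by ring. apply Rabs_triang.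
Qed.

Lemma mopen_open_set U : mopen (fun x y : R => Rabs (x - y)) U -> open_set U.
Proof.
intros HU x Hx. destruct (HU x Hx) as (r & Hr & Hball).
exists (mkposreal r Hr). intros y Hy. apply Hball. rewrite Rabs_minus_sym. exact Hy.
Qed.

Lemma Rabs_dist_proper : mproper (fun x y : R => Rabs (x - y)).
Proof.
intros A HA [x0 [r Hb]] J U HU HAU.
assert (Hc : compact A).
{ apply compact_P5; [now apply mopen_open_set|].
  exists (x0 - r), (x0 + r). intros x Hx. apply Hb, Rabs_le_between in Hx. lra. }
(* [J] may be empty when [A] is; a point of [A] supplies the default index that makes [sel]
   total. *)
destruct (classic (exists a, A a)) as [[a Ha] | Hn].
2:{ exists []. intros x Hx. exfalso. eauto. }
destruct (HAU a Ha) as [j0 _].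
assert (C : forall x, exists j, A x -> U j x).
{ intros x. destruct (classic (A x)) as [Hx | Hx].
  - destruct (HAU x Hx) as [j Hj]. now exists j.
  - exists j0. tauto. }
set (sel x := proj1_sig (constructive_indefinite_description _ (C x))).
assert (Hsel : forall x, A x -> U (sel x) x)
  by (intros x; exact (proj2_sig (constructive_indefinite_description _ (C x)))).
destruct (Hc (mkfamily A (fun x y => A x /\ U (sel x) y)
  (fun x H => match H with ex_intro _ P => proj1 P end))) as [D [Hcov [l Hl]]].
- split.
  + intros x Hx. exists x. simpl. auto.
  + intros x y [Hx Hy]. simpl.
    destruct (mopen_open_set _ (HU (sel x)) y Hy) as [d Hd].
    exists d. intros z Hz. split; [assumption | now apply Hd].
- exists (map sel l). intros x Hx. destruct (Hcov x Hx) as [y [[Hy1 Hy2] Hy3]].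
  exists (sel y). split; [|assumption]. apply in_map, Hl. split; assumption.
Qed.

Definition real_line : PMS := {|
  car := R; dist := fun x y => Rabs (x - y); pt := 0;
  dist_metric := Rabs_dist_metric; dist_proper := Rabs_dist_proper |}.

Lemma real_line_CAT0 : CAT0 real_line.
Proof.
apply stewart_CAT0.
- intros x y. exists (fun s => x + s * (y - x)). unfold geodesic_between; simpl in *.
  split; [ring|]. split; [ring|]. intros s t _ _.
  rewrite (Rabs_minus_sym x y), <- Rabs_mult. simpl. f_equal. ring.
- change (stewart (fun x y : R => Rabs (x - y))). intros p q r m t Ht H1 H2.
  assert (Hm : m = (1 - t) * q + t * r).
  { revert H1 H2.
    destruct (Rtotal_order q r) as [H | [-> | H]]; unfold Rabs; repeat destruct Rcase_abs; nra. }
  rewrite !pow2_abs, Hm. apply Req_le. ring.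
Qed.

(** * Finite nets, counting, and bump functions on a compact metric space *)

Lemma ball_net (X : PMS) (r s : R) : 0 < s ->
  exists l : list (car X), forall z, dist X (pt X) z <= r ->
    exists c, In c l /\ dist X z c < s.
Proof.
intros Hs. destruct (dist_metric X) as (x0 & _ & xs & xt).
destruct (dist_proper X (fun z => dist X (pt X) z <= r)) with
  (I := car X) (U := fun c z => dist X z c < s) as [l Hl].
- intros z Hz. exists (dist X (pt X) z - r). split; [lra|].
  intros y Hy Hy'. specialize (xt (pt X) y z). rewrite (xs y z) in xt. lra.
- now exists (pt X), r.
- intros c z Hz. exists (s - dist X z c). split; [lra|].
  intros y Hy. specialize (xt y z c). rewrite (xs y z) in xt. lra.
- intros z _. exists z. now rewrite x0.
- now exists l.
Qed.

Lemma pigeonhole {A B : Type} (b0 : B) (P : A -> B -> Prop) (l : list A) (c : list B) :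
  NoDup l -> (forall a, In a l -> exists b, In b c /\ P a b) ->
  (forall a a' b, In a l -> In a' l -> P a b -> P a' b -> a = a') ->
  (length l <= length c)%nat.
Proof.
intros Hl Hex Hinj.
assert (C : forall a, exists b, In a l -> In b c /\ P a b).
{ intros a. destruct (classic (In a l)) as [Ha | Ha].
  - destruct (Hex a Ha) as [b Hb]. now exists b.
  - now exists b0. }
apply choice in C. destruct C as [f Hf].
rewrite <- (length_map f l). apply NoDup_incl_length.
- apply NoDup_map_NoDup_ForallPairs; [|assumption].
  intros a a' Ha Ha' E. apply (Hinj a a' (f a)); auto; [|rewrite E]; now apply Hf.
- intros b Hb. apply in_map_iff in Hb. destruct Hb as (a & <- & Ha). now apply Hf.
Qed.

Lemma list_lower_bound {A : Type} (l : list A) (g : A -> R) :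
  (forall a, In a l -> 0 < g a) -> exists e, 0 < e /\ forall a, In a l -> e <= g a.
Proof.
induction l as [|a l IH]; intros Hg.
- exists 1. split; [lra | intros a []].
- destruct IH as (e & He & Hl); [intros b Hb; apply Hg; now right|].
  exists (Rmin e (g a)). split.
  + apply Rmin_pos; [assumption | apply Hg; now left].
  + intros b [<- | Hb]; [apply Rmin_r | eapply Rle_trans; [apply Rmin_l | auto]].
Qed.

Definition clamp (r : R) : R := Rmax 0 (Rmin 1 r).

Lemma clamp_range r : 0 <= clamp r <= 1.
Proof.
unfold clamp. split; [apply Rmax_l|]. apply Rmax_lub; [lra | apply Rmin_l].
Qed.

Lemma clamp_lip r s : Rabs (clamp r - clamp s) <= Rabs (r - s).
Proof.
unfold clamp, Rmax, Rmin, Rabs.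
repeat destruct Rle_dec; repeat destruct Rcase_abs; lra.
Qed.

Lemma clamp_1 r : 1 <= r -> clamp r = 1.
Proof. intros. unfold clamp. rewrite Rmin_left, Rmax_right; lra. Qed.

Lemma clamp_0 r : r <= 0 -> clamp r = 0.
Proof. intros. unfold clamp. rewrite Rmin_right, Rmax_left; lra. Qed.

Lemma metric_dist_lip {T : Type} (d : T -> T -> R) (Hd : is_metric d) x y p :
  Rabs (d x p - d y p) <= d x y.
Proof.
destruct Hd as (_ & _ & ds & dt).
pose proof (dt x y p). pose proof (dt y x p). rewrite (ds y x) in *.
apply Rabs_le. lra.
Qed.

Section Bumps.

Context {H : Type} (dH : H -> H -> R) (dH_metric : is_metric dH).
Context (H_compact : mcompact dH (fun _ => True)).

Lemma compact_net s : 0 < s -> exists l : list H, forall x, exists p, In p l /\ dH x p < s.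
Proof.
intros Hs. destruct dH_metric as (d0 & _ & ds & dt).
destruct (H_compact H (fun c x => dH x c < s)) as [l Hl].
- intros c z Hz. exists (s - dH z c). split; [lra|].
  intros y Hy. specialize (dt y z c). rewrite (ds y z) in dt. lra.
- intros x _. exists x. now rewrite d0.
- exists l. auto.
Qed.

(** At scale a, a bump is 1 within 1/(a+1) of its centre and 0 beyond 2/(a+1); it is discarded when
    its centre is too near [F]. Cantor's pairing gives a <= k, hence the slope bound [INR k + 1]. *)
Lemma separating_bumps (F : list H) : exists f : nat -> H -> R,
  (forall k x, 0 <= f k x <= 1) /\
  (forall k x y, Rabs (f k x - f k y) <= (INR k + 1) * dH x y) /\
  (forall k p, In p F -> f k p = 0) /\
  (forall x y, x <> y -> ~ In x F -> exists k, f k x = 1 /\ f k y = 0).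
Proof.
pose proof (metric_pseudo _ dH_metric) as HP.
pose proof (pseudo_nonneg _ HP) as dn.
destruct dH_metric as (d0 & dsep & ds & dt).
destruct (classic (inhabited H)) as [[x0] | Hemp].
2:{ exists (fun _ _ => 0). repeat split; intros;
    try (exfalso; apply Hemp; constructor; assumption); lra. }
assert (Hpos : forall a, 0 < INR a + 1) by (intros a; pose proof (pos_INR a); lra).
assert (C : forall a : nat, exists l, forall x, exists p, In p l /\ dH x p < / (INR a + 1))
  by (intros a; apply compact_net, Rinv_0_lt_compat, Hpos).
apply choice in C. destruct C as [net Hnet].
(* [k] codes a scale [/ (a + 1)] together with a member of the net at that scale *)
set (scale k := fst (Cantor.of_nat k)).
set (center k := nth (snd (Cantor.of_nat k)) (net (scale k)) x0).
set (bump k x := clamp (2 - (INR (scale k) + 1) * dH x (center k))).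
set (away k := forall p, In p F -> 2 <= (INR (scale k) + 1) * dH p (center k)).
assert (Hscale : forall k, INR (scale k) <= INR k).
{ intros k. apply le_INR. pose proof (Cantor.to_nat_non_decreasing
    (fst (Cantor.of_nat k)) (snd (Cantor.of_nat k))) as K.
  rewrite <- surjective_pairing, Cantor.cancel_to_of in K. unfold scale. lia. }
exists (fun k x => if excluded_middle_informative (away k) then bump k x else 0).
split; [|split; [|split]].
- intros k x. destruct excluded_middle_informative; [apply clamp_range | lra].
- intros k x y. specialize (Hscale k). specialize (Hpos (scale k)).
  pose proof (dn x y) as Nxy. pose proof (pos_INR k).
  destruct excluded_middle_informative.
  + eapply Rle_trans; [apply clamp_lip|].
    replace (2 - (INR (scale k) + 1) * dH x (center k) -
      (2 - (INR (scale k) + 1) * dH y (center k)))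
      with ((INR (scale k) + 1) * (dH y (center k) - dH x (center k))) by ring.
    rewrite Rabs_mult, Rabs_pos_eq by lra.
    apply Rmult_le_compat; [lra | apply Rabs_pos | lra |].
    rewrite (ds x y). now apply metric_dist_lip.
  + rewrite Rminus_diag, Rabs_R0. apply Rmult_le_pos; lra.
- intros k p Hp. destruct excluded_middle_informative as [Ha | _]; [|reflexivity].
  apply clamp_0. specialize (Ha p Hp). lra.
- intros x y Hxy Hx.
  destruct (list_lower_bound (y :: F) (dH x)) as (e & He & Hle).
  { intros p Hp. specialize (dn x p). destruct (Req_dec (dH x p) 0) as [E | E]; [|lra].
    apply dsep in E. subst p. destruct Hp as [-> | Hp]; contradiction. }
  (* The 3 splits as 1 for the distance from [x] to the net point and 2 for the support of the bump,
     which then misses [y] and [F]. *)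
  destruct (archimed_cor1 (e / 3)) as (a & Ha & Ha0); [lra|].
  assert (Ia : 0 < INR a) by (now apply lt_0_INR).
  assert (Hae : 3 <= (INR a + 1) * e).
  { apply Rmult_lt_compat_l with (r := INR a) in Ha; [|assumption].
    rewrite Rinv_r in Ha by lra. lra. }
  destruct (Hnet a x) as (p & Hp & Hxp).
  apply (In_nth _ _ x0) in Hp. destruct Hp as (b & _ & Hb).
  exists (Cantor.to_nat (a, b)).
  assert (Es : scale (Cantor.to_nat (a, b)) = a)
    by (unfold scale; now rewrite Cantor.cancel_of_to).
  assert (Ec : center (Cantor.to_nat (a, b)) = p)
    by (unfold center; rewrite Es, Cantor.cancel_of_to; exact Hb).
  assert (Hxp1 : (INR a + 1) * dH x p <= 1).
  { apply Rle_trans with ((INR a + 1) * / (INR a + 1)); [apply Rmult_le_compat_l; lra|].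
    rewrite Rinv_r; lra. }
  assert (Hfar : forall q, In q (y :: F) -> 2 <= (INR a + 1) * dH q p).
  { intros q Hq. specialize (Hle q Hq). specialize (dt x p q). rewrite (ds p q) in dt.
    assert ((INR a + 1) * e <= (INR a + 1) * (dH x p + dH q p))
      by (apply Rmult_le_compat_l; lra). lra. }
  destruct excluded_middle_informative as [_ | Hn].
  + unfold bump. rewrite Es, Ec. split.
    * apply clamp_1. lra.
    * apply clamp_0. specialize (Hfar y (or_introl eq_refl)). lra.
  + exfalso. apply Hn. intros q Hq. rewrite Es, Ec. apply Hfar. now right.
Qed.

End Bumps.

(** For continuity of the inverse: if [Phi z] is close to [Phi x] while z is near some y far from
    [x], then continuity at y makes [Phi y] close to [Phi x], against separation. Compactness makes
    finitely many such y suffice. *)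
Lemma GH_embedding_of_close {H : Type} (dH : H -> H -> R) (Phi : H -> PMS) :
  is_metric dH -> mcompact dH (fun _ => True) ->
  (forall x, CAT0 (Phi x)) ->
  (forall x t, 0 < t -> exists delta, 0 < delta /\
     forall y, dH x y < delta -> close (Phi y) (Phi x) t) ->
  (forall x y, x <> y -> exists e, 0 < e /\ ~ close (Phi x) (Phi y) e) ->
  GH_embedding dH Phi.
Proof.
intros (d0 & _ & ds & dt) Hcomp HC Hcont Hsep.
split; [assumption|]. split; [|split].
- intros x y Hxy. apply NNPP. intros Hne. destruct (Hsep x y Hne) as (e & He & Hn).
  apply Hn. now apply pointed_isometric_close.
- intros x eps Heps. destruct (Hcont x (eps / 2)) as (d & Hd & Hc); [lra|].
  exists d. split; [assumption|]. intros y Hy.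
  apply Rle_lt_trans with (eps / 2); [now apply close_GHstar, Hc | lra].
- intros x d Hd.
  assert (C : forall y, exists r e, 0 < r /\ 0 < e <= / 2 /\ forall z, dH z y < r ->
     close (Phi z) (Phi x) e -> dH x z < d).
  { intros y. destruct (Rlt_le_dec (dH x y) d) as [Hlt | Hge].
    - exists (d - dH x y), (/ 2). split; [lra|]. split; [lra|]. intros z Hz _.
      specialize (dt x y z). rewrite (ds y z) in dt. lra.
    - destruct (Hsep y x) as (e & He & Hn).
      { intros ->. rewrite d0 in Hge. lra. }
      (* Two steps of size [e'] add up to less than [e], and each stays in the range of
         [close_trans]. *)
      set (e' := Rmin (/ 2) (e / 3)).
      assert (0 < e') by (apply Rmin_pos; lra).
      pose proof (Rmin_l (/ 2) (e / 3)) as M1. pose proof (Rmin_r (/ 2) (e / 3)) as M2.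
      fold e' in M1, M2.
      destruct (Hcont y e') as (r & Hr & Hc); [assumption|].
      exists r, e'. split; [assumption|]. split; [lra|]. intros z Hz Hzx.
      exfalso. apply Hn. apply (close_trans _ (Phi z) _ e' e'); try lra; [|assumption].
      apply close_sym, Hc. now rewrite ds. }
  apply choice in C. destruct C as [r C]. apply choice in C. destruct C as [e C].
  destruct (Hcomp H (fun y z => dH z y < r y)) as [l Hl].
  + intros y z Hz. exists (r y - dH z y). split; [lra|].
    intros w Hw. specialize (dt w z y). rewrite (ds w z) in dt. lra.
  + intros y _. exists y. rewrite d0. apply C.
  (* Adding [x] to the list ensures [m <= e x <= / 2], the range of [GHstar_close]. *)
  + destruct (list_lower_bound (x :: l) e) as (m & Hm & Hle); [intros; apply C|].
    exists m. split; [assumption|]. intros z Hz.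
    destruct (GHstar_close _ _ _ (Rle_trans _ _ _ (Hle x (or_introl eq_refl))
      (proj2 (proj1 (proj2 (C x))))) Hz) as (t & Ht & Hclose).
    destruct (Hl z I) as (y & Hy & Hzy).
    apply (proj2 (proj2 (C y)) z Hzy). apply close_mono with t; [|assumption].
    specialize (Hle y (or_intror Hy)). lra.
Qed.

(** * The family of wedges indexed by H *)

Section RichWedge.

Context (n : nat) (X : nat -> PMS) (HX : forall i, (i <= n)%nat -> CAT0 (X i)).
Context {H : Type} (dH : H -> H -> R) (dH_metric : is_metric dH) (v : nat -> H).
Context (sep : R) (sep_pos : 0 < sep).
Context (v_sep : forall i j, (i <= n)%nat -> (j <= n)%nat -> i <> j ->
  sep <= dH (v i) (v j)).
Context (f : nat -> H -> R) (f_range : forall k x, 0 <= f k x <= 1).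
Context (f_lip : forall k x y, Rabs (f k x - f k y) <= (INR k + 1) * dH x y).
Context (f_v : forall k i, (i <= n)%nat -> f k (v i) = 0).

(* [inl i] is the branch [X i]; [inr (k, m)] is the [m]-th leg of level [k].
   [Nat.min] makes every [inl] branch one of the given CAT(0) spaces. *)
Definition index : Type := (nat + nat * nat)%type.

Definition branch (i : index) : PMS :=
  match i with inl i => X (Nat.min i n) | inr _ => real_line end.

Lemma branch_CAT0 i : CAT0 (branch i).
Proof. destruct i; [apply HX, Nat.le_min_r | apply real_line_CAT0]. Qed.

(** The ratio [/ 8] makes twice the next scale a quarter of the present one, so levels above [k]
    stay within [leg_scale k / 2] of the base point. The exponent [S k] keeps every rho of a leg at
    most [/ 8], whence rho/(1-rho) <= 2 rho. *)
Definition leg_scale (k : nat) : R := (/ 8) ^ S k.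

Lemma leg_scale_pos k : 0 < leg_scale k.
Proof. apply pow_lt. lra. Qed.

Lemma leg_scale_S k : leg_scale (S k) = leg_scale k / 8.
Proof. unfold leg_scale. simpl. field. Qed.

Lemma leg_scale_le k : leg_scale k <= / 8.
Proof.
induction k as [|k IH]; [unfold leg_scale; simpl; lra|].
rewrite leg_scale_S. lra.
Qed.

Lemma leg_scale_anti j k : (j <= k)%nat -> leg_scale k <= leg_scale j.
Proof.
induction 1 as [|k _ IH]; [lra|]. pose proof (leg_scale_pos k). rewrite leg_scale_S. lra.
Qed.

Lemma leg_scale_INR k : leg_scale k * (INR k + 1) <= 1.
Proof.
induction k as [|k IH]; [unfold leg_scale; simpl; lra|].
rewrite leg_scale_S, S_INR. pose proof (leg_scale_pos k). pose proof (pos_INR k). nra.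
Qed.

Lemma leg_scale_small r : 0 < r -> exists k, leg_scale k < r.
Proof.
intros Hr. destruct (pow_lt_1_zero (/ 8)) with (y := r) as [N HN]; [|assumption|].
{ rewrite Rabs_pos_eq; lra. }
exists N. specialize (HN (S N) (Nat.le_succ_diag_r N)).
rewrite Rabs_pos_eq in HN; [assumption | left; apply leg_scale_pos].
Qed.

(** The height bound 2 is generous: the points looked up later have height below
    [2 * leg_scale k]. *)
Lemma branch_net_exists k i : exists l : list (branch_pt branch),
  forall p, projT1 p = i -> height branch p <= 2 ->
  exists c, In c l /\ wdist branch p c < leg_scale k / 2.
Proof.
destruct (ball_net (branch i) 2 (leg_scale k / 2)) as [l Hl].
{ pose proof (leg_scale_pos k). lra. }
exists (map (bpt branch i) l). intros [j z] E Hz. simpl in E. subst j.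
destruct (Hl z Hz) as (c & Hc & Hd). exists (bpt branch i c).
split; [now apply in_map|]. fold (bpt branch i z). now rewrite wdist_same.
Qed.

Definition branch_net (k : nat) (i : index) : list (branch_pt branch) :=
  proj1_sig (constructive_indefinite_description _ (branch_net_exists k i)).

Lemma branch_net_spec k p : height branch p <= 2 ->
  exists c, In c (branch_net k (projT1 p)) /\ wdist branch p c < leg_scale k / 2.
Proof.
apply (proj2_sig (constructive_indefinite_description _
  (branch_net_exists k (projT1 p))) p eq_refl).
Qed.

(* More legs at level [k] than it takes balls of radius [leg_scale k / 2] to
   cover everything of lower level together with the base point. *)
Definition leg_number (k : nat) (l : list index) : nat :=
  S (S (length (flat_map (branch_net k) l))).

(** Levels and leg numbers are built together: the number of legs at level [k] depends on nets of
    all the branches listed before. *)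
Fixpoint levels_below (k : nat) : list index :=
  match k with
  | O => map inl (seq 0 (S n))
  | S k => levels_below k ++
      map (fun m => inr (k, m)) (seq 0 (leg_number k (levels_below k)))
  end.

Definition legs (k : nat) : nat := leg_number k (levels_below k).

Lemma levels_below_inl k i : (i <= n)%nat -> In (inl i) (levels_below k).
Proof.
intros Hi. induction k as [|k IH].
- apply (in_map inl), in_seq. lia.
- simpl. apply in_app_iff. now left.
Qed.

Lemma levels_below_inr k j m :
  (j < k)%nat -> (m < legs j)%nat -> In (inr (j, m)) (levels_below k).
Proof.
intros Hj Hm. induction Hj as [|k _ IH]; simpl; apply in_app_iff; [right | now left].
apply (in_map (fun m => inr (j, m)) (seq 0 (legs j)) m), in_seq. lia.
Qed.

(** With [sep] the least gap between the [v i], the value on branch X_i is 1 at [v i] and 0 at every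
    other [v j]. Surplus indices get radius 0 and disappear. *)
Definition radius (x : H) (i : index) : R :=
  match i with
  | inl i => if le_dec i n then clamp (1 - dH x (v i) / sep) else 0
  | inr (k, m) => if lt_dec m (legs k) then leg_scale k * f k x else 0
  end.

Lemma radius_range x i : 0 <= radius x i <= 1.
Proof.
destruct i as [i | [k m]]; simpl.
- destruct le_dec; [apply clamp_range | lra].
- destruct lt_dec; [|lra]. specialize (f_range k x).
  pose proof (leg_scale_pos k). pose proof (leg_scale_le k). split; nra.
Qed.

(** [trunc_close] asks for uniformity over all branches; on legs it comes from
    [leg_scale k * (INR k + 1) <= 1]. *)
Lemma radius_lip x y i : Rabs (radius x i - radius y i) <= (1 + / sep) * dH x y.
Proof.
pose proof (pseudo_nonneg _ (metric_pseudo _ dH_metric) x y) as Nxy.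
assert (Hs : 0 < / sep) by now apply Rinv_0_lt_compat.
assert (H0 : Rabs (0 - 0) <= (1 + / sep) * dH x y).
{ rewrite Rminus_diag, Rabs_R0. apply Rmult_le_pos; lra. }
destruct i as [i | [k m]]; simpl.
- destruct le_dec; [|assumption].
  eapply Rle_trans; [apply clamp_lip|].
  replace (1 - dH x (v i) / sep - (1 - dH y (v i) / sep))
    with (/ sep * - (dH x (v i) - dH y (v i))) by (field; lra).
  rewrite Rabs_mult, Rabs_Ropp, Rabs_pos_eq by lra.
  pose proof (metric_dist_lip dH dH_metric x y (v i)). nra.
- destruct lt_dec; [|assumption].
  pose proof (leg_scale_pos k) as Hk.
  rewrite <- Rmult_minus_distr_l, Rabs_mult, Rabs_pos_eq by lra.
  apply Rle_trans with (leg_scale k * ((INR k + 1) * dH x y)).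
  + apply Rmult_le_compat_l; [lra | apply f_lip].
  + pose proof (leg_scale_INR k). rewrite <- Rmult_assoc. nra.
Qed.

Lemma height_outside_levels x k p :
  in_radius branch (radius x) p -> ~ In (projT1 p) (levels_below k) ->
  height branch p <= 2 * leg_scale k.
Proof.
destruct p as [i z]. unfold in_radius. simpl projT1.
intros Hp Hi. pose proof (height_nonneg branch (existT _ i z)) as Hn.
pose proof (leg_scale_pos k) as Hk.
set (h := height branch _) in *. clearbody h.
destruct i as [i | [j m]]; simpl in Hp.
- destruct le_dec as [Hle | _]; [|lra].
  exfalso. now apply Hi, levels_below_inl.
- destruct lt_dec as [Hlt | _]; [|lra].
  destruct (le_lt_dec k j) as [Hkj | Hjk].
  + apply leg_scale_anti in Hkj. specialize (f_range j x).
    pose proof (leg_scale_pos j). pose proof (leg_scale_le j).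
    assert (0 <= leg_scale j * f j x <= leg_scale j) by nra. nra.
  + exfalso. now apply Hi, levels_below_inr.
Qed.

Lemma radius_vanish x r : 0 < r -> exists l : list index,
  forall p, in_radius branch (radius x) p -> ~ In (projT1 p) l -> height branch p < r.
Proof.
intros Hr. destruct (leg_scale_small (r / 2)) as [k Hk]; [lra|].
exists (levels_below k). intros p Hp Hi.
pose proof (height_outside_levels x k p Hp Hi). lra.
Qed.

Definition rich_wedge (x : H) : PMS :=
  trunc_PMS branch (inl 0%nat) (radius x) (radius_range x) (radius_vanish x).

Lemma rich_wedge_CAT0 x : CAT0 (rich_wedge x).
Proof. apply trunc_CAT0, branch_CAT0. Qed.

Lemma rich_wedge_continuous x t : 0 < t ->
  exists delta, 0 < delta /\
    forall y, dH x y < delta -> close (rich_wedge y) (rich_wedge x) t.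
Proof.
intros Ht. assert (Hs : 0 < / sep) by now apply Rinv_0_lt_compat.
set (e := (t / (1 + t)) ^ 2 * t / 4).
assert (He : 0 < e).
{ assert (0 < t / (1 + t)) by (apply Rdiv_lt_0_compat; lra).
  unfold e. assert (0 < (t / (1 + t)) ^ 2) by nra. nra. }
exists (e / (1 + / sep)). split; [apply Rdiv_lt_0_compat; lra|].
intros y Hy. apply trunc_close; auto using branch_CAT0.
intros i. rewrite Rabs_minus_sym. eapply Rle_trans; [apply radius_lip|]. fold e.
apply Rmult_lt_compat_l with (r := 1 + / sep) in Hy; [|lra].
replace ((1 + / sep) * (e / (1 + / sep))) with e in Hy by (field; lra). lra.
Qed.

Lemma rich_wedge_v i : (i <= n)%nat -> pointed_isometric (rich_wedge (v i)) (X i).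
Proof.
intros Hi. replace (X i) with (branch (inl i)) by (simpl; f_equal; lia).
destruct dH_metric as (d0 & _ & ds & _).
apply trunc_single_branch.
- simpl. destruct le_dec; [|contradiction].
  apply clamp_1. rewrite d0. unfold Rdiv. lra.
- intros [j | [k m]] Hj; simpl.
  + destruct le_dec as [Hjn | _]; [|reflexivity].
    apply clamp_0. assert (Hij : i <> j) by congruence.
    specialize (v_sep i j Hi Hjn Hij).
    apply Rmult_le_compat_r with (r := / sep) in v_sep;
      [|left; now apply Rinv_0_lt_compat].
    rewrite Rinv_r in v_sep by lra. unfold Rdiv. lra.
  + destruct lt_dec; [|reflexivity]. rewrite f_v by assumption. ring.
Qed.

(* Near the base point, the level [k] legs of the wedge at [x] form a
   [leg_scale k]-separated set too large for the wedge at [y]. *)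
Lemma rich_wedge_separated x y k : f k x = 1 -> f k y = 0 ->
  ~ close (rich_wedge x) (rich_wedge y) (leg_scale k / 2).
Proof.
intros Hx Hy (c & (C0 & C1 & C2 & C3 & C4) & Hp & HW & _).
pose proof (leg_scale_pos k) as Hk. pose proof (leg_scale_le k) as Hk8.
set (s := leg_scale k) in *.
set (tip m := bpt branch (inr (k, m)) s : branch_pt branch).
assert (Htip : forall m, height branch (tip m) = s).
{ intros m. unfold height; simpl. rewrite Rabs_left1; lra. }
assert (Ea : forall m, exists a : car (rich_wedge x), (m < legs k)%nat ->
   wdist branch (proj1_sig a) (tip m) = 0).
{ intros m. destruct (lt_dec m (legs k)) as [Hm | Hm].
  - destruct (trunc_rep branch (inl 0%nat) (radius x) (radius_range x) (tip m))
      as [a Ha]; [|now exists a].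
    unfold in_radius. rewrite Htip. simpl. destruct lt_dec; [|contradiction].
    rewrite Hx. fold s. nra.
  - exists (pt (rich_wedge x)). intros Hm'. contradiction. }
apply choice in Ea. destruct Ea as [a Ha].
assert (Eq : forall m, exists q : car (rich_wedge y), (m < legs k)%nat ->
   c (a m) q < s / 2).
{ intros m. destruct (lt_dec m (legs k)) as [Hm | Hm].
  - destruct (HW (a m)) as [q Hq]; [|now exists q].
    simpl. rewrite tdist_tpt.
    rewrite <- (wdist_pt branch (inl 0%nat)), wdist_sym.
    rewrite (wdist_zero_eq branch _ _ (Ha m Hm)), wdist_sym, wdist_pt, Htip.
    apply Rle_trans with 1; [lra|]. rewrite <- Rinv_1 at 1.
    apply Rinv_le_contravar; lra.
  - exists (pt (rich_wedge y)). intros Hm'. contradiction. }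
apply choice in Eq. destruct Eq as [q Hq].
(* Through the base points, the height is at most s/2 + s + s/2. *)
assert (Hheight : forall m, (m < legs k)%nat -> height branch (proj1_sig (q m)) <= 2).
{ intros m Hm. specialize (Hq m Hm).
  specialize (C4 (pt (rich_wedge x)) (pt (rich_wedge y)) (q m)).
  simpl in C4. rewrite tdist_tpt in C4.
  specialize (C1 (pt (rich_wedge x)) (a m) (q m)).
  simpl in C1. rewrite tdist_tpt in C1.
  rewrite <- (wdist_pt branch (inl 0%nat) (proj1_sig (a m))), wdist_sym in C1.
  rewrite (wdist_zero_eq branch _ _ (Ha m Hm)), wdist_sym, wdist_pt, Htip in C1.
  simpl in Hp. lra. }
(* Distinct tips are 2s apart, and passing to their partners loses less than s/2 at each end. *)
assert (Hsep : forall m m', (m < legs k)%nat -> (m' < legs k)%nat -> m <> m' ->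
   s < wdist branch (proj1_sig (q m)) (proj1_sig (q m'))).
{ intros m m' Hm Hm' Hne. pose proof (Hq m Hm). pose proof (Hq m' Hm').
  specialize (C3 (a m) (a m') (q m)). specialize (C2 (a m') (q m) (q m')).
  simpl in C2, C3. unfold tdist in C2, C3.
  rewrite (wdist_zero_eq branch _ _ (Ha m Hm)), wdist_sym,
    (wdist_zero_eq branch _ _ (Ha m' Hm')) in C3.
  unfold tip in C3. rewrite wdist_diff in C3 by congruence.
  fold (tip m) (tip m') in C3. rewrite !Htip in C3.
  rewrite (wdist_sym branch (proj1_sig (q m'))) in C2. lra. }
assert (Hlen : (length (seq 0 (legs k)) <=
  length (bpt branch (inl 0%nat) (pt (branch (inl 0%nat))) ::
    flat_map (branch_net k) (levels_below k)))%nat).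
{ apply (pigeonhole (bpt branch (inl 0%nat) (pt (branch (inl 0%nat))))
    (fun m b => wdist branch (proj1_sig (q m)) b < s / 2)).
  - apply seq_NoDup.
  - intros m Hm. apply in_seq in Hm.
    destruct (classic (In (projT1 (proj1_sig (q m))) (levels_below k))) as [Hi | Hi].
    + destruct (branch_net_spec k (proj1_sig (q m))) as (b & Hb & Hd);
        [apply Hheight; lia|].
      exists b. split; [|assumption]. right. apply in_flat_map. eauto.
    (* Outside the lower levels, the wedge at [y] is near its base point: the level [k] legs are cut
       to nothing since [f k y = 0], and the higher ones have height at most s/4. *)
    + eexists. split; [now left|]. rewrite wdist_sym, wdist_pt.
      destruct (q m) as [[i z] [Hz Hz0]]. simpl in Hi |- *.
      destruct (classic (In i (levels_below (S k)))) as [Hi' | Hi'].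
      * change (levels_below (S k)) with
          (levels_below k ++ map (fun m => inr (k, m)) (seq 0 (legs k))) in Hi'.
        apply in_app_iff in Hi'. destruct Hi' as [Hi' | Hi'];
          [contradiction|].
        apply in_map_iff in Hi'. destruct Hi' as (m' & <- & _).
        unfold in_radius in Hz. simpl in Hz. rewrite Hy, Rmult_0_r in Hz.
        destruct lt_dec; lra.
      * pose proof (height_outside_levels y (S k) _ Hz Hi') as K.
        rewrite leg_scale_S in K. fold s in K. lra.
  - intros m m' b Hm Hm' H1 H2. apply in_seq in Hm, Hm'.
    destruct (Nat.eq_dec m m') as [E | E]; [assumption|].
    specialize (Hsep m m' ltac:(lia) ltac:(lia) E).
    pose proof (proj2 (proj2 (wdist_pseudo branch)) (proj1_sig (q m)) b
      (proj1_sig (q m'))) as K.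
    rewrite (wdist_sym branch b) in K. lra. }
(* There are two more legs than net points, and the base point accounts for only one of them. *)
rewrite length_seq in Hlen. unfold legs, leg_number in Hlen. simpl in Hlen. lia.
Qed.

End RichWedge.

Theorem theorem1p4 (n : nat) (Hn : (1 <= n)%nat)
  (H : Type) (dH : H -> H -> R) (dH_metric : is_metric dH)
  (H_compact : mcompact dH (fun _ => True))
  (v : nat -> H)
  (v_distinct : forall i j, (i <= n)%nat -> (j <= n)%nat -> i <> j -> v i <> v j)
  (X : nat -> PMS)
  (X_CAT0 : forall i, (i <= n)%nat -> CAT0 (X i))
  (X_sep : forall i j, (i <= n)%nat -> (j <= n)%nat -> i <> j ->
             0 < GHstar (X i) (X j)) :
  exists Phi : H -> PMS,
    GH_embedding dH Phi /\
    forall i, (i <= n)%nat -> pointed_isometric (Phi (v i)) (X i).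
Proof.
(* The diagonal pairs get the dummy value 1, so that all entries are positive. *)
destruct (list_lower_bound (list_prod (seq 0 (S n)) (seq 0 (S n)))
  (fun ij => if Nat.eq_dec (fst ij) (snd ij) then 1 else dH (v (fst ij)) (v (snd ij))))
  as (sep & sep_pos & Hsep).
{ intros [i j] Hij. apply in_prod_iff in Hij. rewrite !in_seq in Hij. simpl.
  destruct Nat.eq_dec as [E | E]; [lra|].
  pose proof (pseudo_nonneg _ (metric_pseudo _ dH_metric) (v i) (v j)).
  destruct (Req_dec (dH (v i) (v j)) 0) as [E' | E']; [|lra].
  apply dH_metric in E'. exfalso. apply (v_distinct i j); auto; lia. }
assert (v_sep : forall i j, (i <= n)%nat -> (j <= n)%nat -> i <> j ->
  sep <= dH (v i) (v j)).
{ intros i j Hi Hj Hij. specialize (Hsep (i, j)). cbn [fst snd] in Hsep.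
  destruct Nat.eq_dec; [contradiction|]. apply Hsep.
  apply in_prod; apply in_seq; lia. }
destruct (separating_bumps dH dH_metric H_compact (map v (seq 0 (S n))))
  as (f & f_range & f_lip & f_F & f_sep).
assert (HF : forall x, In x (map v (seq 0 (S n))) <-> exists i, (i <= n)%nat /\ x = v i).
{ intros x. rewrite in_map_iff. split.
  - intros (i & <- & Hi). apply in_seq in Hi. exists i. split; [lia | reflexivity].
  - intros (i & Hi & ->). exists i. rewrite in_seq. split; [reflexivity | lia]. }
assert (f_v : forall k i, (i <= n)%nat -> f k (v i) = 0).
{ intros k i Hi. apply f_F, HF. eauto. }
exists (rich_wedge n X dH v sep f f_range).
assert (Hv : forall i, (i <= n)%nat ->
  pointed_isometric (rich_wedge n X dH v sep f f_range (v i)) (X i))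
  by (intros i Hi; apply rich_wedge_v; assumption).
split; [|assumption].
apply GH_embedding_of_close; auto.
- intros x. now apply rich_wedge_CAT0.
- intros x t. now apply rich_wedge_continuous.
- assert (Hoff : forall x y, x <> y -> ~ In x (map v (seq 0 (S n))) -> exists e, 0 < e /\
    ~ close (rich_wedge n X dH v sep f f_range x) (rich_wedge n X dH v sep f f_range y) e).
  { intros x y Hxy Hx. destruct (f_sep x y Hxy Hx) as (k & Hkx & Hky).
    exists (leg_scale k / 2). split; [pose proof (leg_scale_pos k); lra|].
    now apply rich_wedge_separated. }
  intros x y Hxy.
  destruct (classic (In x (map v (seq 0 (S n))))) as [Hx | Hx]; [|now apply Hoff].
  destruct (classic (In y (map v (seq 0 (S n))))) as [Hy | Hy].
  (* The bumps need the point where they equal 1 to be off the [v i]; closeness being symmetric, [x]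
     and [y] may be exchanged. *)
  2:{ destruct (Hoff y x) as (e & He & Hne); auto. exists e. split; [assumption|].
      intros Hc. now apply Hne, close_sym. }
  apply HF in Hx. destruct Hx as (i & Hi & ->).
  apply HF in Hy. destruct Hy as (j & Hj & ->).
  assert (Hij : i <> j) by congruence.
  specialize (X_sep i j Hi Hj Hij).
  set (g := GHstar (X i) (X j)) in *.
  (* X_i and X_j are joined by three links of size [e]; the strict inequality in [close_trans] makes
     this [5 * e], which is less than [g]. The bound [/ 16] keeps [3 * e] below [/ 2]. *)
  set (e := Rmin (/ 16) (g / 8)).
  assert (He : 0 < e) by (apply Rmin_pos; lra).
  pose proof (Rmin_l (/ 16) (g / 8)) as M1. pose proof (Rmin_r (/ 16) (g / 8)) as M2.
  fold e in M1, M2.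
  exists e. split; [assumption|]. intros Hc.
  assert (Hc1 : close (X i) (rich_wedge n X dH v sep f f_range (v j)) (3 * e)).
  { apply (close_trans _ (rich_wedge n X dH v sep f f_range (v i)) _ e e); auto; try lra.
    apply close_sym, pointed_isometric_close; auto. }
  assert (Hc2 : close (X i) (X j) (5 * e)).
  { apply (close_trans _ (rich_wedge n X dH v sep f f_range (v j)) _ (3 * e) e); try lra;
      auto. apply pointed_isometric_close; auto. }
  apply close_GHstar in Hc2. fold g in Hc2. lra.
Qed.
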